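(* Let $T$ be a finite set and let $X_t=(X_{t,k})_{0\leq k\leq n}$, $t\in T$, be a family of discrete-time martingales with respect to the same filtration. Consider the metric $$d(s,t)=\Big(\sum_{k=1}^n\|\Delta_k(X_t-X_s)\|_\infty^2\Big)^{1/2}$$ on $T$. Then, with $C_2,D_2>0$ the universal constants specified in the context, for any $u\geq 1$, $$\mathbb{P}\Big(\sup_{t\in T}|X_{t,n}-X_{t,0}|\geq\sqrt e\,\big(C_2\gamma_2(T,d)+D_2\Delta_d(T)u\big)\Big)\leq e^{-u^2/2}.$$
   Context: For a process $Y=(Y_k)_{0\leq k\leq n}$, $\Delta_k(Y)=Y_k-Y_{k-1}$ denotes its $k$-th difference, and $\|\cdot\|_\infty$ is the essential supremum norm. The diameter is $\Delta_d(T)=\sup_{s,t\in T}d(s,t)$. A sequence $\mathcal{T}=(T_k)_{k\geq 0}$ of subsets of $T$ is admissible if $|T_0|=1$ and $|T_k|\leq 2^{2^k}$ for all $k\geq 1$. With $d(t,T_k)=\inf_{s\in T_k}d(t,s)$, put $\gamma_2(T,d)=\inf_{\mathcal{T}}\sup_{t\in T}\sum_{k=0}^\infty 2^{k/2}d(t,T_k)$ and, for $1\leq p<\infty$, $\gamma_{2,p}(T,d)=\inf_{\mathcal{T}}\sup_{t\in T}\sum_{k\geq\lfloor\log_2 p\rfloor}2^{k/2}d(t,T_k)$, the infima being over all admissible sequences. The constants $C_2,D_2>0$ are the universal constants from the following general chaining bound for $\psi_2$-processes. If $(Y_t)_{t\in T}$ is a process with values in a normed space, indexed by a finite semi-metric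 space $(T,d)$, such that $\mathbb{P}(\|Y_t-Y_s\|\geq u\,d(t,s))\leq 2\exp(-u^2)$ for all $s,t\in T$ and $u\geq 0$, then for any $t_0\in T$ and $1\leq p<\infty$, $$\Big(\mathbb{E}\sup_{t\in T}\|Y_t-Y_{t_0}\|^p\Big)^{1/p}\leq C_2\gamma_{2,p}(T,d)+2\sup_{t\in T}(\mathbb{E}\|Y_t-Y_{t_0}\|^p)^{1/p},$$ and for any $u\geq 1$, $$\mathbb{P}\Big(\sup_{t\in T}\|Y_t-Y_{t_0}\|\geq\sqrt e\,(C_2\gamma_2(T,d)+uD_2\Delta_d(T))\Big)\leq\exp(-u^2/2).$$
   Formalization: Added: Δ_d(T)>0 and some t0 in T with X_{t0,n}=X_{t0,0} a.s. (false otherwise, e.g. T a singleton); C_2,D_2 are some constants valid for both the corollary and the chaining bound, the latter with strict increment inequality and its tail part only for positive diameter. *)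

(* Defs.v *)
From HB Require Import structures.
From mathcomp Require Import all_boot all_order all_algebra.
From mathcomp Require Import all_classical all_reals all_analysis.

Set Implicit Arguments.
Unset Strict Implicit.
Unset Printing Implicit Defensive.

Import Order.TTheory GRing.Theory Num.Theory.
Import numFieldNormedType.Exports.
Local Open Scope classical_set_scope.
Local Open Scope ring_scope.
Local Open Scope ereal_scope.

Section chaining_functionals.
Context {R : realType} {T : finType}.

(* Distances are extended-real valued, so that the essential supremum norms in
   [mart_dist] below need not be assumed finite. *)
Implicit Types d : T -> T -> \bar R.

Definition diameter d : \bar R :=
  ereal_sup (range (fun st : T * T => d st.1 st.2)).

(* Equals +oo when [A] is empty. *)
Definition dist_to_set d (t : T) (A : {set T}) : \bar R :=
  ereal_inf [set d t s | s in [set` A]].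

Definition admissible (A : nat -> {set T}) : Prop :=
  #|A 0%N| = 1%N /\ forall k, (1 <= k)%N -> (#|A k| <= 2 ^ (2 ^ k))%N.

Definition gamma2_from (l : nat) d : \bar R :=
  ereal_inf [set ereal_sup (range (fun t : T =>
      \sum_(l <= k <oo) (2 `^ (k%:R / 2))%:E * dist_to_set d t (A k)))
    | A in [set A | admissible A]].

Definition gamma2 d : \bar R := gamma2_from 0%N d.

Definition gamma2p (p : R) d : \bar R :=
  gamma2_from (Num.truncn (ln p / ln 2)%R) d.

Definition semi_metric (d : T -> T -> R) : Prop :=
  [/\ forall t, d t t = 0%R,
      forall s t, d s t = d t s &
      forall r s t, (d r t <= d r s + d s t)%R].

End chaining_functionals.

(* The chaining bound for psi_2-processes with constants [C2] and [D2].
   - The increment condition has a strict inequality. When [d s t > 0] this is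
     equivalent to the condition with a weak one; when [d s t = 0], and in
     particular when [s = t], it says that [Y s = Y t] almost surely, while the
     condition with a weak inequality would be unsatisfiable there.
   - The tail bound is for a positive diameter: otherwise it would bound the
     probability of the sure event [0 <= sup] by a number less than 1.
   - [V] need not be separable, so measurability is required of the norms of
     the increments, which is all that the statement refers to. *)
Definition psi2_chaining_bound {R : realType} (C2 D2 : R) : Prop :=
  forall (disp : measure_display) (Om : measurableType disp)
    (P : probability Om R) (V : normedModType R) (T : finType)
    (d : T -> T -> R) (Y : T -> Om -> V),
  semi_metric d ->
  (forall s t, measurable_fun [set: Om] (fun w => `|Y t w - Y s w|%R)) ->
  (forall s t (u : R), (0 <= u)%R ->
    P [set w | (u * d t s < `|Y t w - Y s w|)%R]
      <= (2 * expR (- u ^+ 2))%:E) ->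
  let dE := (fun s t => (d s t)%:E) in
  forall t0 : T,
  let supY := fun w => ereal_sup (range (fun t => (`|Y t w - Y t0 w|%R)%:E)) in
  (forall p : R, (1 <= p)%R ->
    'N[P]_(p%:E) [supY]
      <= C2%:E * gamma2p p dE
         + 2%:E * ereal_sup (range (fun t =>
             'N[P]_(p%:E) [(fun w => (`|Y t w - Y t0 w|%R)%:E)])))
  /\
  (0 < diameter dE -> forall u : R, (1 <= u)%R ->
    P [set w | (Num.sqrt (expR 1))%:E
                 * (C2%:E * gamma2 dE + u%:E * D2%:E * diameter dE) <= supY w]
      <= (expR (- (u ^+ 2 / 2)))%:E).

Section martingales.
Context {R : realType} {disp : measure_display} {Om : measurableType disp}.
Variable P : probability Om R.

Definition sub_sigma_algebra (G : set (set Om)) : Prop :=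
  sigma_algebra [set: Om] G /\ G `<=` measurable.

Definition filtration (n : nat) (F : nat -> set (set Om)) : Prop :=
  (forall k, (k <= n)%N -> sub_sigma_algebra (F k)) /\
  (forall j k, (j <= k <= n)%N -> F j `<=` F k).

Definition measurable_wrt (G : set (set Om)) (X : Om -> R) : Prop :=
  forall B : set R, measurable B -> G (X @^-1` B).

(* [Y] is a version of E[X | G]. *)
Definition is_cond_exp (G : set (set Om)) (X Y : Om -> R) : Prop :=
  [/\ measurable_wrt G Y,
      P.-integrable [set: Om] (EFin \o Y) &
      forall A, G A -> \int[P]_(w in A) (Y w)%:E = \int[P]_(w in A) (X w)%:E].

(* Only the values [X k] with [k <= n] matter. *)
Definition martingale (n : nat) (F : nat -> set (set Om))
    (X : nat -> Om -> R) : Prop :=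
  (forall k, (k <= n)%N ->
    measurable_wrt (F k) (X k) /\ P.-integrable [set: Om] (EFin \o X k)) /\
  (forall k, (k < n)%N -> is_cond_exp (F k) (X k.+1) (X k)).

Definition difference (k : nat) (Y : nat -> Om -> R) : Om -> R :=
  fun w => (Y k w - Y k.-1 w)%R.

Definition mart_dist {T : finType} (n : nat) (X : T -> nat -> Om -> R)
    (s t : T) : \bar R :=
  sqrte (\sum_(1 <= k < n.+1)
    'N[P]_+oo [EFin \o difference k (fun j w => (X t j w - X s j w)%R)] ^+ 2).

End martingales.

(* Main.v *)
(* Chaining by moments.  If rho / d is subgaussian for a random semi-metric rho,
   then exp ((rho / d)^2 / 16) has bounded expectation.  Given an admissible
   sequence A_k, let W^p be 1 plus the sum, over all k and all links (a, b) in
   A_k x A_(k+1), of exp ((rho(a, b) / d(a, b))^2 / 16 - 4 * 2^k).  The at most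
   8^(2^k) links of level k contribute geometrically little, so W is bounded in
   L^p, while rho(a, b) <= 8 * 2^(k/2) * W * d(a, b) on every link as soon as
   p <= 2^(k+1).  Chaining from the level l = floor (log_2 p) bounds
   sup_t rho(t0, t) by max_{s in A_l} rho(t0, s) + C * gamma_{2,p} * W, and the
   maximum over A_l costs a factor |A_l|^(1/p) <= 2 in L^p.  The tail bound is
   Markov's inequality with p = u^2.

   The increments of X_n - X_0 are subgaussian for d by Azuma's inequality.  The
   crude bound cosh x <= exp (2 x^2) only gives exp (- u^2 / 8), which is why the
   chaining bound is needed under this weaker tail hypothesis. *)
Require Import Defs.
From HB Require Import structures.
From mathcomp Require Import all_boot all_order all_algebra.
From mathcomp Require Import all_classical all_reals all_analysis.
From mathcomp Require Import ring lra measurable_realfun ess_sup_inf.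

Import Order.TTheory GRing.Theory Num.Theory.
Import numFieldNormedType.Exports.
Local Open Scope classical_set_scope.
Local Open Scope ring_scope.
Local Open Scope ereal_scope.

(** * Threshold events and elementary exponential inequalities *)

Lemma measurable_set_lt d (Om : measurableType d) (R : realType) (f : Om -> R)
    (a : R) : measurable_fun setT f -> measurable [set w | a < f w]%R.
Proof.
move=> mf; rewrite (_ : [set w | _] = f @^-1` `]a, +oo[).
  by rewrite -[X in measurable X]setTI; exact: mf.
by apply/seteqP; split => w /=; rewrite in_itv/= andbT.
Qed.

Lemma measurable_set_le d (Om : measurableType d) (R : realType) (f : Om -> R)
    (a : R) : measurable_fun setT f -> measurable [set w | a <= f w]%R.
Proof.
move=> mf; rewrite (_ : [set w | _] = f @^-1` `[a, +oo[).
  by rewrite -[X in measurable X]setTI; exact: mf.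
by apply/seteqP; split => w /=; rewrite in_itv/= andbT.
Qed.

Lemma ln_le_half_sqrB1 {R : realType} (y : R) :
  (0 < y)%R -> (ln y <= (y ^+ 2 - 1) / 2)%R.
Proof.
move=> y0; rewrite ler_pdivlMr// mulr_natr -lnXn//.
rewrite -{1}(subrKC 1%R (y ^+ 2)); apply: le_ln1Dx.
by rewrite ltrBrDl subrr exprn_gt0.
Qed.

(** The 1 covers [y <= 1]; for [y > 1], [p * ln y <= 2 * m * ln y <= m * (y^2 - 1)]. The extra
    factor 4 makes the exponent at [m = 2^k], [y = z / (8 * 2^(k/2))] equal to [z^2 / 16 - 4 * 2^k],
    as in [link]. *)
Lemma powR_le_1D_expR {R : realType} (p y : R) (m : nat) :
  (0 <= y)%R -> (0 <= p <= (2 * m)%:R)%R ->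
  (y `^ p <= 1 + expR ((4 * m)%:R * (y ^+ 2 - 1)))%R.
Proof.
move=> y0 /andP[p0 pm]; have [y1|y1] := leP y 1%R.
  apply: (@le_trans _ _ 1%R); last by rewrite lerDl expR_ge0.
  have := @ge0_ler_powR R p p0 y 1%R; rewrite powR1; apply; rewrite ?nnegrE//.
apply: ler_wpDl => //; have y_gt0 : (0 < y)%R by exact: lt_trans y1.
rewrite /powR gt_eqF// ler_expR.
have lny := ln_le_half_sqrB1 _ y_gt0.
have m0 : (0 <= m%:R :> R)%R by [].
have ln0 : (0 <= ln y)%R by rewrite ln_ge0// ltW.
have : (p * ln y <= (2 * m)%:R * ln y)%R by rewrite ler_wpM2r.
rewrite !natrM; nra.
Qed.

(** With [y = z / (3 * u)], [u^2 * ln y <= u^2 * (y^2 - 1) / 2 <= z^2 / 18]; 3 is the least integer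
    [c] with [1 / (2 * c^2) <= 1 / 16]. *)
Lemma powR_sqr_le_expR {R : realType} (u z : R) :
  (0 < u)%R -> (0 <= z)%R ->
  (z `^ (u ^+ 2) <= (3 * u) `^ (u ^+ 2) * expR (z ^+ 2 / 16))%R.
Proof.
move=> u0 z0; have u30 : (0 < 3 * u)%R by rewrite mulr_gt0.
have [->|zn0] := eqVneq z 0%R.
  by rewrite powR0 ?mulr_ge0 ?powR_ge0 ?expR_ge0// expf_neq0// gt_eqF.
have {zn0}z0 : (0 < z)%R by rewrite lt_neqAle eq_sym zn0.
rewrite -[in leLHS](@divfK _ (3 * u)%R _ z) ?gt_eqF//.
rewrite (powRM _ (ltW (divr_gt0 z0 u30)) (ltW u30)) mulrC.
rewrite ler_wpM2l ?powR_ge0//.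
have yu0 : (0 < z / (3 * u))%R by rewrite divr_gt0.
rewrite /powR gt_eqF// ler_expR.
apply: le_trans (_ : u ^+ 2 * (((z / (3 * u)) ^+ 2 - 1) / 2) <= _)%R.
  by rewrite ler_wpM2l ?exprn_ge0 ?ln_le_half_sqrB1// ltW.
have -> : ((z / (3 * u)) ^+ 2 = z ^+ 2 / 9 / u ^+ 2)%R.
  by field; rewrite gt_eqF.
rewrite mulrA mulrBr mulr1 mulrCA divff ?mulr1 ?expf_neq0 ?gt_eqF//.
have := sqr_ge0 z; have := sqr_ge0 u; lra.
Qed.

Lemma expR1_ge2 {R : realType} : (2 <= expR 1 :> R)%R.
Proof. by have := @expR_ge1Dx R 1; lra. Qed.

Lemma sum_half_le2 {R : realType} n : (\sum_(0 <= i < n) 2^-1 ^+ i <= 2 :> R)%R.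
Proof.
suff : (\sum_(0 <= i < n) 2^-1 ^+ i = 2 - 2 * 2^-1 ^+ n :> R)%R.
  by move=> ->; rewrite gerBl mulr_ge0// exprn_ge0.
elim: n => [|n IHn]; first by rewrite big_geq// expr0; ring.
by rewrite big_nat_recr//= IHn exprS; field.
Qed.

(** The value of the layer cake: [e] plus the sum over [i] of [exp (i + 2) * 2 * exp (- 2 * i)], the
    sum of [exp (- i)] being at most that of [2^-i], hence at most 2. *)
Definition moment_cst {R : realType} : R := (expR 1 + 4 * expR 2)%R.

Lemma moment_cst_ge1 {R : realType} : (1 <= moment_cst :> R)%R.
Proof.
have := @expR1_ge2 R; have := @expR_ge0 R 2; rewrite /moment_cst; lra.
Qed.

(* Layer cake: [exp q <= e + \sum_i exp (i + 2) 1_{q > i}]. *)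
Lemma subgaussian_moment d (Om : measurableType d) (R : realType)
    (P : probability Om R) (Z : Om -> R) :
  measurable_fun setT Z -> (forall w, 0 <= Z w)%R ->
  (forall u : R, (0 <= u)%R ->
    P [set w | (u < Z w)%R] <= (2 * expR (- (u ^+ 2 / 8)))%:E) ->
  \int[P]_w (expR (Z w ^+ 2 / 16))%:E <= moment_cst%:E.
Proof.
move=> mZ Z0 tailZ.
(* With [q = Z^2 / 16], [A i] is the event [q > i]; the tail at [u = 4 * sqrt i] gives it
   probability at most [2 * exp (- 2 * i)]. *)
pose A i := [set w | 4 * Num.sqrt i%:R < Z w]%R.
have mA i : measurable (A i) by exact: measurable_set_lt.
pose f i w : \bar R := (expR i.+2%:R)%:E * (\1_(A i) w)%:E.
have f0 i w : 0 <= f i w by rewrite mule_ge0 ?lee_fin ?expR_ge0.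
have mf i : measurable_fun setT (f i).
  apply: measurable_funeM; apply/measurable_EFinP.
  exact: measurable_indic.
have mexp : measurable_fun setT (fun w => (expR (Z w ^+ 2 / 16))%:E : \bar R).
  apply/measurable_EFinP; apply: measurableT_comp => //.
  by apply: measurable_funM => //; exact: measurable_funX.
have mSf : measurable_fun setT (fun w => \sum_(i <oo) f i w).
  exact: (@ge0_emeasurable_sum _ _ _ _ f xpredT (fun k w _ _ => f0 k w)
    (fun k _ => mf k)).
apply: le_trans (_ : \int[P]_w ((expR 1)%:E + \sum_(i <oo) f i w) <= _).
  apply: ge0_le_integral => //.
  - exact: emeasurable_funD.
  - move=> w _; have q0 : (0 <= Z w ^+ 2 / 16)%R by rewrite divr_ge0// sqr_ge0.
    have /andP[jq qj] := truncn_itv q0.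
    (* If [q < 1] the constant [e] suffices; if [j + 1 <= q < j + 2], the term of index [j] alone
       does. *)
    case: (Num.truncn _) jq qj => [|j] jq qj.
      apply: (@le_trans _ _ ((expR 1)%:E + 0)).
        by rewrite adde0 lee_fin ler_expR ltW.
      by rewrite leeD2l// nneseries_ge0.
    apply: (@le_trans _ _ (0 + f j w)).
      rewrite add0e /f indicE mem_set ?mule1 ?lee_fin ?ler_expR; first exact: ltW.
      rewrite /A /=.
      rewrite -(@ltr_pXn2r _ 2%N) ?nnegrE ?mulr_ge0 ?sqrtr_ge0//.
      rewrite exprMn sqr_sqrtr//.
      have : (j%:R < j.+1%:R :> R)%R by rewrite ltr_nat.
      move: jq; lra.
    apply: leeD; first by rewrite lee_fin expR_ge0.
    apply: le_trans (nneseries_lim_ge j.+1 _); last by move=> *; exact: f0.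
    by rewrite big_nat_recr//= leeDr// sume_ge0.
rewrite ge0_integralD//; last by move=> w _; exact: nneseries_ge0.
rewrite integral_nneseries// /moment_cst EFinD; apply: leeD.
  rewrite -[X in X <= _]/(\int[P]_w cst (expR 1)%:E w) integral_cst//.
  by rewrite [X in _ * X]probability_setT mule1.
apply: lime_le.
  by apply: is_cvg_nneseries => i _ _; apply: integral_ge0.
apply: nearW => n.
apply: le_trans (_ : \sum_(0 <= i < n) (2 * expR 2 * 2^-1 ^+ i)%:E <= _).
  apply: lee_sum => i _.
  rewrite ge0_integralZl_EFin ?expR_ge0//; last first.
    by apply/measurable_EFinP; exact: measurable_indic.
  rewrite integral_indic// setIT.
  apply: (@le_trans _ _ ((expR i.+2%:R)%:E * (2 * expR (- i%:R *+ 2))%:E)).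
    rewrite lee_pmul2l ?lte_fin ?expR_gt0//.
    apply: le_trans (tailZ _ _) _; first by rewrite mulr_ge0.
    rewrite lee_fin ler_wpM2l// ler_expR exprMn sqr_sqrtr//; lra.
  rewrite -EFinM lee_fin mulrCA -mulrA ler_wpM2l// -expRD.
  rewrite -[_.+2]addn2 natrD (_ : _ + _ + _ = 2 + - i%:R)%R; last by ring.
  rewrite expRD ler_wpM2l ?expR_ge0// expRN -[i%:R]mulr1 expRM_natl -exprVn.
  rewrite lerXn2r ?nnegrE ?invr_ge0 ?expR_ge0//.
  by rewrite lef_pV2 ?posrE ?expR_gt0// expR1_ge2.
rewrite sumEFin lee_fin -mulr_sumr.
have := @sum_half_le2 R n; have := @expR_ge0 R 2; nra.
Qed.

(** * Moments: comparison, domination and finite maxima *)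

Section Lnorm_bounds.
Context d (Om : measurableType d) (R : realType) (P : probability Om R).

Lemma measurable_powR_norm (f : Om -> R) (p : R) :
  measurable_fun setT f ->
  measurable_fun setT (fun w => (`|f w| `^ p)%:E : \bar R).
Proof.
move=> mf; apply/measurable_EFinP.
apply: (measurableT_comp (f := fun x : R => (x `^ p)%R)) => //.
exact: measurableT_comp.
Qed.

Lemma ae_le_Lnorm (f g : Om -> R) (p : R) :
  measurable_fun setT f -> measurable_fun setT g -> (0 < p)%R ->
  {ae P, forall w, `|f w| <= `|g w|}%R ->
  'N[P]_p%:E[EFin \o f] <= 'N[P]_p%:E[EFin \o g].
Proof.
move=> mf mg p0 fg; rewrite unlock /=.
apply: gt0_ler_poweR;
  rewrite ?invr_ge0 ?(ltW p0)// ?in_itv/= ?leey ?andbT ?integral_ge0//.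
apply: ae_ge0_le_integral => //.
- exact: measurable_powR_norm.
- exact: measurable_powR_norm.
- apply: filterS fg => w fg _; rewrite lee_fin.
  by apply: ge0_ler_powR; rewrite ?nnegrE ?(ltW p0).
Qed.

Lemma Lnorm_le_cst (f : Om -> R) (p c : R) : (0 < p)%R -> (0 <= c)%R ->
  \int[P]_w (`|f w| `^ p)%:E <= (c `^ p)%:E -> 'N[P]_p%:E[EFin \o f] <= c%:E.
Proof.
move=> p0 c0 fc; rewrite unlock /=.
rewrite -[c in leRHS](powRr1 c0) -(divff (lt0r_neq0 p0)) powRrM.
rewrite -poweR_EFin; apply: gt0_ler_poweR => //.
- by rewrite invr_ge0 ltW.
- by rewrite in_itv/= leey andbT integral_ge0.
- by rewrite in_itv/= leey andbT lee_fin powR_ge0.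
Qed.

(** Integration gives [c * K^(1/p)]; [K >= 1] and [p >= 1] replace [K^(1/p)] by [K], which does not
    depend on [p]. *)
Lemma Lnorm_le_dominated (f g : Om -> R) (p c K : R) :
  measurable_fun setT f -> measurable_fun setT g -> (forall w, 0 <= g w)%R ->
  (1 <= p)%R -> (0 <= c)%R -> (1 <= K)%R ->
  {ae P, forall w, `|f w| `^ p <= c `^ p * g w}%R ->
  \int[P]_w (g w)%:E <= K%:E -> 'N[P]_p%:E[EFin \o f] <= (c * K)%:E.
Proof.
move=> mf mg g0 p1 c0 K1 fg gK.
have K0 : (0 <= K)%R by exact: le_trans K1.
have p0 : (0 < p)%R by exact: lt_le_trans p1.
apply: Lnorm_le_cst; rewrite ?mulr_ge0//.
apply: (@le_trans _ _ (\int[P]_w ((c `^ p)%:E * (g w)%:E))).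
  apply: ae_ge0_le_integral => //.
  - exact: measurable_powR_norm.
  - by move=> w _; rewrite mule_ge0// lee_fin ?powR_ge0.
  - by apply: measurable_funeM; exact/measurable_EFinP.
  - by apply: filterS fg => w fg _; rewrite -EFinM lee_fin.
rewrite ge0_integralZl_EFin ?powR_ge0//; last 2 first.
- by move=> w _; rewrite lee_fin.
- exact/measurable_EFinP.
apply: (@le_trans _ _ ((c `^ p)%:E * K%:E)).
  by rewrite lee_wpmul2l// lee_fin powR_ge0.
rewrite -EFinM lee_fin powRM// ler_wpM2l ?powR_ge0//.
by rewrite -{1}[K]powRr1// ler_powR.
Qed.

End Lnorm_bounds.

Lemma measurable_bigmaxr d (Om : measurableType d) (R : realType) (I : Type)
    (s : seq I) (Q : pred I) (f : I -> Om -> R) :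
  (forall i, measurable_fun setT (f i)) ->
  measurable_fun setT (fun w => \big[Num.max/0%R]_(i <- s | Q i) f i w).
Proof.
move=> mf; elim: s => [|i s IHs].
  by under eq_fun do rewrite big_nil; exact: measurable_cst.
under eq_fun do rewrite big_cons.
by case: (Q i) => //; exact: measurable_maxr.
Qed.

Lemma powR_bigmax_le_sum {R : realType} (I : Type) (s : seq I) (Q : pred I)
    (f : I -> R) (p : R) : (0 < p)%R -> (forall i, 0 <= f i)%R ->
  ((\big[Num.max/0]_(i <- s | Q i) f i) `^ p <= \sum_(i <- s | Q i) f i `^ p)%R.
Proof.
move=> p0 f0; elim: s => [|i s IHs]; first by rewrite !big_nil powR0// gt_eqF.
rewrite !big_cons; case: (Q i) => //.
have [_|_] := leP (f i); last by rewrite lerDl sumr_ge0// => j _; rewrite powR_ge0.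
by rewrite (le_trans IHs)// lerDr powR_ge0.
Qed.

Lemma bigmaxr_ge0 {R : realDomainType} (I : Type) (s : seq I) (Q : pred I)
    (f : I -> R) :
  (forall i, 0 <= f i)%R -> (0 <= \big[Num.max/0]_(i <- s | Q i) f i)%R.
Proof. by move=> f0; elim/big_rec: _ => // i x _ x0; rewrite le_max f0. Qed.

(** The p-th power of the maximum is at most the sum of the p-th powers; this costs [|A|^(1/p)], at
    most 2 by the bound on [#|A|]. *)
Lemma Lnorm_bigmax d (Om : measurableType d) (R : realType)
    (P : probability Om R) (I : finType) (A : {set I}) (f : I -> Om -> R) (p M : R) :
  (forall i, measurable_fun setT (f i)) -> (forall i w, 0 <= f i w)%R ->
  (0 < p)%R -> (0 <= M)%R -> (#|A|%:R <= 2 `^ p)%R ->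
  (forall i, 'N[P]_p%:E[EFin \o f i] <= M%:E) ->
  'N[P]_p%:E[EFin \o (fun w => \big[Num.max/0%R]_(i in A) f i w)] <= (2 * M)%:E.
Proof.
move=> mf f0 p0 M0 cardA fM.
apply: Lnorm_le_cst => //; first by rewrite mulr_ge0.
have mfp i : measurable_fun setT (fun w => (`|f i w| `^ p)%:E : \bar R).
  exact: measurable_powR_norm.
apply: (@le_trans _ _ (\int[P]_w (\sum_(i <- enum A) (`|f i w| `^ p)%:E))).
  apply: ge0_le_integral => //.
  - by apply: measurable_powR_norm; exact: measurable_bigmaxr.
  - exact: emeasurable_sum.
  - move=> w _; rewrite ger0_norm; last exact: bigmaxr_ge0.
    rewrite sumEFin lee_fin big_enum/=.
    apply: le_trans (powR_bigmax_le_sum _ _ _ _ _ p0 (fun i => f0 i w)) _.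
    by apply: ler_sum => i _; rewrite ger0_norm.
rewrite ge0_integral_sum//.
apply: (@le_trans _ _ (\sum_(i <- enum A) (M `^ p)%:E)).
  apply: lee_sum => i _.
  have -> : \int[P]_w (`|f i w| `^ p)%:E = \int[P]_w `|(EFin \o f i) w| `^ p by [].
  rewrite -poweR_Lnorm ?gt_eqF// -poweR_EFin.
  by apply: (gt0_ler_poweR (ltW p0));
    rewrite ?in_itv/= ?leey ?andbT ?lee_fin ?Lnorm_ge0 ?fM.
rewrite sumEFin lee_fin big_enum/= sumr_const -[leLHS]mulr_natl powRM//.
by rewrite ler_wpM2r ?powR_ge0.
Qed.

(** * The chaining weights *)

Section sqrt2pow.
Context {R : realType}.

Definition sqrt2pow (k : nat) : R := 2 `^ (k%:R / 2).

Lemma sqrt2pow_gt0 k : (0 < sqrt2pow k)%R.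
Proof. exact: powR_gt0. Qed.

Lemma sqr_sqrt2pow k : (sqrt2pow k ^+ 2 = (2 ^ k)%:R)%R.
Proof. by rewrite -powR_mulrn ?powR_ge0// -powRrM divfK// powR_mulrn// natrX. Qed.

Lemma le_sqrt2pow j k : (j <= k)%N -> (sqrt2pow j <= sqrt2pow k)%R.
Proof. by move=> jk; rewrite ler_powR ?ler1n// ler_wpM2r// ler_nat. Qed.

Lemma sqrt2pow_unbounded (x : R) : exists n, (x < sqrt2pow n)%R.
Proof.
(* An even index turns the weight into an integer power of two, and [2^m > m]. *)
exists (2 * (Num.truncn `|x|).+1)%N.
rewrite /sqrt2pow mulnC natrM mulfK// powR_mulrn// -natrX.
apply: le_lt_trans (ler_norm x) _.
have /andP[_ xt] := truncn_itv (normr_ge0 x).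
by apply: lt_trans xt _; rewrite ltr_nat ltn_expl.
Qed.

End sqrt2pow.

(** * Generic chaining *)

(** The point [t0] matters: over an empty type the supremum is -oo and the maximum is 0. *)
Lemma ereal_sup_range_bigmax {R : realType} (T : finType) (t0 : T) (f : T -> R) :
  (forall t, 0 <= f t)%R ->
  ereal_sup (range (fun t => (f t)%:E)) = (\big[Num.max/0%R]_t f t)%:E.
Proof.
move=> f0; apply/eqP; rewrite eq_le; apply/andP; split.
  by apply: ge_ereal_sup => _ [t _ <-]; rewrite lee_fin; exact: le_bigmax.
have f0_le : 0 <= ereal_sup (range (fun t => (f t)%:E)).
  apply: le_trans; last by apply: ereal_sup_ubound; exists t0.
  by rewrite lee_fin.
elim/big_ind: _ => // [x y xs ys|t _].
- by rewrite EFin_max ge_max xs ys.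
- by apply: ereal_sup_ubound; exists t.
Qed.

Lemma markov_ge0 d (Om : measurableType d) (R : realType)
    (P : probability Om R) (g : Om -> R) (a : R) :
  measurable_fun setT g -> (forall w, 0 <= g w)%R -> (0 <= a)%R ->
  a%:E * P [set w | a <= g w]%R <= \int[P]_w (g w)%:E.
Proof.
move=> mg g0 a0.
have mA : measurable [set w | a <= g w]%R by exact: measurable_set_le.
rewrite -[[set w | _]]setIT -integral_indic// -ge0_integralZl_EFin//; last first.
  by apply/measurable_EFinP; exact: measurable_indic.
apply: ge0_le_integral => //.
- by move=> w _; rewrite mule_ge0.
- by apply: measurable_funeM; apply/measurable_EFinP; exact: measurable_indic.
- exact/measurable_EFinP.
- move=> w _; rewrite -EFinM lee_fin indicE.
  have [|_] := boolP (w \in _); last by rewrite mulr0.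
  by rewrite inE/= mulr1.
Qed.

Lemma truncn_log2_itv {R : realType} (p : R) : (1 <= p)%R ->
  ((2 ^ Num.truncn (ln p / ln 2))%:R <= p <= (2 * 2 ^ Num.truncn (ln p / ln 2))%:R)%R.
Proof.
move=> p1; have p0 : (0 < p)%R by exact: lt_le_trans p1.
have ln2 : (0 < ln 2 :> R)%R by rewrite ln_gt0// ltr1n.
have lp0 : (0 <= ln p / ln 2)%R by exact: divr_ge0 (ln_ge0 p1) (ltW ln2).
have /andP[] := truncn_itv lp0; set l := Num.truncn _.
rewrite ler_pdivlMr// ltr_pdivrMr// => l1 l2.
rewrite -expnS !natrX -!powR_mulrn// /powR pnatr_eq0/=.
by apply/andP; split; rewrite -ler_ln ?posrE ?expR_gt0// expRK//; exact: ltW.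
Qed.

Section gamma2_facts.
Context {R : realType} {T : finType} (d : T -> T -> \bar R).
Hypothesis d_ge0 : forall s t, 0 <= d s t.

Lemma dist_to_set_ge0 t (A : {set T}) : 0 <= dist_to_set d t A.
Proof. by apply: le_ereal_inf_tmp => _ [s _ <-]. Qed.

Lemma gamma2_from_term_ge0 (A : nat -> {set T}) k t :
  0 <= (2 `^ (k%:R / 2))%:E * dist_to_set d t (A k).
Proof. by rewrite mule_ge0 ?lee_fin ?powR_ge0 ?dist_to_set_ge0. Qed.

Lemma gamma2_from_ge0 (t0 : T) l : 0 <= gamma2_from l d.
Proof.
apply: le_ereal_inf_tmp => _ [A _ <-].
apply: le_trans; last by apply: ereal_sup_ubound; exists t0.
by apply: nneseries_ge0 => k _ _; exact: gamma2_from_term_ge0.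
Qed.

Lemma gamma2_from_le l : gamma2_from l d <= gamma2 d.
Proof.
apply: le_ereal_inf_tmp => _ [A admA <-].
apply: le_trans; first by apply: ereal_inf_lbound; exists A.
apply: ge_ereal_sup => _ [t _ <-].
apply: le_trans; last by apply: ereal_sup_ubound; exists t.
rewrite (@nneseries_split _ _ 0 l)// => [|k _]; last exact: gamma2_from_term_ge0.
by rewrite add0n leeDr// sume_ge0// => k _; exact: gamma2_from_term_ge0.
Qed.

End gamma2_facts.

(** As [T] is finite, the infimum in [dist_to_set] is attained; [pi k t] is a nearest point of
    [A k]. *)
Lemma projection_sequence {R : realType} {T : finType} (d : T -> T -> R)
    (A : nat -> {set T}) (l : nat) (t0 : T) (S : R) :
  let dE s t := (d s t)%:E in
  (forall s t, 0 <= d s t)%R ->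
  (forall t, \sum_(l <= k <oo) (2 `^ (k%:R / 2))%:E * dist_to_set dE t (A k) <= S%:E) ->
  exists pi : nat -> T -> T,
    (forall k t, (l <= k)%N -> pi k t \in A k) /\
    (forall n t, \sum_(l <= k < n) sqrt2pow k * d t (pi k t) <= S)%R.
Proof.
move=> dE d_ge0 AS.
have dE_ge0 s t : 0 <= dE s t by rewrite lee_fin.
have partial n t : \sum_(l <= k < n) (sqrt2pow k)%:E * dist_to_set dE t (A k) <= S%:E.
  apply: le_trans (AS t); apply: nneseries_lim_ge => k _ _.
  exact: gamma2_from_term_ge0.
(* An empty [A k] is at distance +oo from every point, which the finite bound [S] excludes from
   level [l] on. Below [l] the default projection is [t0]. *)
have A_neq0 k : (l <= k)%N -> exists s, s \in A k.
  move=> lk; apply/set0Pn; apply/negP => /eqP Ak0.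
  have := partial k.+1 t0; rewrite big_nat_recr//= [X in _ + _ * X](_ : _ = +oo).
    rewrite gt0_muley ?lte_fin ?sqrt2pow_gt0// addey//.
    rewrite gt_eqF// (lt_le_trans ltNy0)// sume_ge0// => *.
    exact: gamma2_from_term_ge0.
  rewrite /dist_to_set Ak0 (_ : [set _ | _ in _] = set0) ?ereal_inf0//.
  by apply/seteqP; split => // x [s]; rewrite /= inE.
have /choice[pi piP] : forall kt : nat * T, exists s, (l <= kt.1)%N ->
    s \in A kt.1 /\ dE kt.2 s <= dist_to_set dE kt.2 (A kt.1).
  move=> [k t] /=; have [/A_neq0[s0 s0A]|_] := boolP (l <= k)%N; last by exists t0.
  have [s sA smin] := @Order.TotalTheory.arg_minP _ _ _ s0 (mem (A k)) (d t) s0A.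
  exists s => _; split=> //; apply: le_ereal_inf_tmp => _ [r /= rA <-].
  by rewrite lee_fin smin.
exists (fun k t => pi (k, t)); split => [k t lk|n t].
  by have [] := piP (k, t) lk.
rewrite -lee_fin -sumEFin; apply: le_trans (partial n t).
rewrite !big_nat; apply: lee_sum => k /andP[lk _].
rewrite EFinM lee_wpmul2l ?lee_fin ?(ltW (sqrt2pow_gt0 k))//.
by have [] := piP (k, t) lk.
Qed.

(** Each link costs a factor 8 and each distance to a projection enters at most two links, whence
    16; the other factor bounds the integral of [link_sum]. *)
Definition chaining_cst {R : realType} : R := 16 * (1 + 2 * moment_cst).

Lemma chaining_cst_gt0 {R : realType} : (0 < chaining_cst :> R)%R.
Proof. by rewrite /chaining_cst; have := @moment_cst_ge1 R; lra. Qed.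

(** The factor 2 of the chaining bound in L^p times the constant [3 * moment_cst] of [Lnorm_rho]. *)
Definition diameter_cst {R : realType} : R := 6 * moment_cst.

Lemma diameter_cst_gt0 {R : realType} : (0 < diameter_cst :> R)%R.
Proof. by rewrite /diameter_cst; have := @moment_cst_ge1 R; lra. Qed.

(** * Chaining for a random semi-metric with subgaussian tails *)

Section subgaussian_semimetric.
Context disp (Om : measurableType disp) (R : realType) (P : probability Om R).
Context (T : finType) (d : T -> T -> R) (rho : T -> T -> Om -> R).
Hypothesis d_semi : semi_metric d.
Hypothesis mrho : forall s t, measurable_fun setT (rho s t).
Hypothesis rho_ge0 : forall s t w, (0 <= rho s t w)%R.
Hypothesis rho_triangle :
  forall r s t w, (rho r t w <= rho r s w + rho s t w)%R.
Hypothesis rho_tail : forall s t (u : R), (0 <= u)%R ->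
  P [set w | (u * d s t < rho s t w)%R] <= (2 * expR (- (u ^+ 2 / 8)))%:E.

Let K : R := moment_cst.
Let K1 : (1 <= K)%R := moment_cst_ge1.
(** Division by zero gives 0, so [z] vanishes where [d] does: its moments are bounded for every
    pair, but [rho] is recovered from it only almost surely. *)
Let z s t w : R := (rho s t w / d s t)%R.

Lemma semi_metric_ge0 s t : (0 <= d s t)%R.
Proof.
by have [d0 dC dT] := d_semi; have := dT s t s; rewrite d0 (dC t s); lra.
Qed.

Let mz s t : measurable_fun setT (z s t).
Proof. exact: measurable_funM. Qed.

Let z_ge0 s t w : (0 <= z s t w)%R.
Proof. by rewrite divr_ge0// semi_metric_ge0. Qed.

Let mexpz s t (a b : R) : measurable_fun setT (fun w => expR (z s t w ^+ 2 / a - b)).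
Proof.
apply: measurableT_comp => //; apply: measurable_funB => //.
by apply: measurable_funM => //; exact: measurable_funX.
Qed.

Lemma normalized_moment s t : \int[P]_w (expR (z s t w ^+ 2 / 16))%:E <= K%:E.
Proof.
apply: subgaussian_moment => // u u0.
have := semi_metric_ge0 s t; rewrite le_eqVlt => /predU1P[d0|d0].
  rewrite [X in P X](_ : _ = set0) ?measure0 ?lee_fin ?mulr_ge0 ?expR_ge0//.
  by apply/seteqP; split => // w; rewrite /= /z -d0 invr0 mulr0 ltNge u0.
rewrite [X in P X](_ : _ = [set w | u * d s t < rho s t w]%R) ?rho_tail//.
by apply/seteqP; split => w; rewrite /= /z ltr_pdivlMr.
Qed.

(** Only [d s t = 0] is at stake: the tail bound then controls the event [rho > 0] for every [u], so
    this event is null. *)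
Lemma rho_le_normalized s t : {ae P, forall w, rho s t w <= d s t * z s t w}%R.
Proof.
have := semi_metric_ge0 s t; rewrite le_eqVlt => /predU1P[d0|d0]; last first.
  by apply: nearW => w; rewrite /z mulrCA divff ?mulr1// gt_eqF.
pose A := [set w | (0 < rho s t w)%R].
have mA : measurable A by exact: measurable_set_lt.
have PA : P A = 0.
  apply/eqP; rewrite eq_le measure_ge0 andbT; apply/lee_addgt0Pr => e e0.
  rewrite add0e.
  (* Here [u^2 / 8 = 2 / e], and [exp (2 / e) >= 1 + 2 / e] yields [2 * exp (- 2 / e) <= e]. *)
  have := rho_tail s t (Num.sqrt (16 / e)) (sqrtr_ge0 _).
  rewrite -d0 mulr0 => /le_trans; apply; rewrite lee_fin.
  rewrite sqr_sqrtr ?divr_ge0 ?(ltW e0)// expRN ler_pdivrMr ?expR_gt0//.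
  have := @expR_ge1Dx R (16 / e / 8).
  rewrite -(ler_pM2l e0) mulrDr mulr1 => /(le_trans _); apply.
  rewrite (_ : e * _ = 2)%R ?lerDr ?(ltW e0)//.
  by field; rewrite gt_eqF.
exists A; split => // w /=; rewrite /A /= -d0 mul0r => /negP.
by rewrite -ltNge.
Qed.

(** Subgaussian moments of order [p] grow like [sqrt p]; with [p = u^2] this is the linear
    dependence on [u] of the diameter term. *)
Lemma Lnorm_rho s t (u : R) : (1 <= u)%R ->
  'N[P]_(u ^+ 2)%:E[EFin \o rho s t] <= (3 * u * d s t * K)%:E.
Proof.
move=> u1; have u0 : (0 < u)%R by exact: lt_le_trans u1.
apply: (@Lnorm_le_dominated _ _ _ _ _ (fun w => expR (z s t w ^+ 2 / 16))) => //.
- by under eq_fun do rewrite -[X in expR X]subr0; exact: mexpz.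
- by rewrite exprn_ege1.
- by rewrite !mulr_ge0 ?semi_metric_ge0 ?(ltW u0).
- apply: filterS (rho_le_normalized s t) => w rz; rewrite ger0_norm//.
  apply: (@le_trans _ _ ((d s t * z s t w) `^ (u ^+ 2))%R).
    apply: (ge0_ler_powR (sqr_ge0 u)); [exact: rho_ge0| |exact: rz].
    exact: mulr_ge0 (semi_metric_ge0 s t) (z_ge0 s t w).
  rewrite powRM ?semi_metric_ge0 ?z_ge0// [(3 * u * _)%R]mulrC.
  rewrite [leRHS](_ : _ = d s t `^ (u ^+ 2) *
      ((3 * u) `^ (u ^+ 2) * expR (z s t w ^+ 2 / 16)))%R.
    by rewrite ler_wpM2l ?powR_ge0// powR_sqr_le_expR ?z_ge0.
  by rewrite [in LHS]powRM ?semi_metric_ge0 ?mulr_ge0 ?(ltW u0)// mulrA.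
- exact: normalized_moment.
Qed.

Let link (k : nat) (x : T * T) (w : Om) : R :=
  expR (z x.1 x.2 w ^+ 2 / 16 - (4 * 2 ^ k)%:R).

Let links (A : nat -> {set T}) (k : nat) : seq (T * T) :=
  enum (finset.setX (A k) (A k.+1)).

(** This is W^p rather than W, so it does not depend on [p]. The cut-off [N] will be a level where
    every projection is at distance 0 from its point. *)
Let link_sum (A : nat -> {set T}) (l N : nat) (w : Om) : R :=
  1 + \sum_(l <= k < N) \sum_(x <- links A k) link k x w.

Let link_sum_ge1 (A : nat -> {set T}) l N w : (1 <= link_sum A l N w)%R.
Proof.
by rewrite lerDl sumr_ge0// => k _; rewrite sumr_ge0// => x _; exact: expR_ge0.
Qed.

Let measurable_link_sum (A : nat -> {set T}) l N : measurable_fun setT (link_sum A l N).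
Proof.
apply: measurable_funD => //; apply: measurable_sum => k.
by apply: measurable_sum => x; exact: mexpz.
Qed.

Let le_link_sum (A : nat -> {set T}) l N k (x : T * T) w :
  (l <= k < N)%N -> x.1 \in A k -> x.2 \in A k.+1 ->
  (1 + link k x w <= link_sum A l N w)%R.
Proof.
move=> kN x1 x2; rewrite lerD2l.
have kr : k \in index_iota l N by rewrite mem_index_iota.
rewrite (bigD1_seq k)//= ?iota_uniq//.
have xr : x \in links A k by rewrite mem_enum finset.inE x1.
rewrite (bigD1_seq x)//= ?enum_uniq// -addrA lerDl.
by rewrite addr_ge0// sumr_ge0// => *; rewrite ?sumr_ge0// => *; exact: expR_ge0.
Qed.

(** With [y = z / (8 * 2^(k/2))], [powR_le_1D_expR] bounds [y^p] by 1 plus one [link], hence by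
    [link_sum]; it applies because [p <= 2 * 2^l <= 2 * 2^k]. *)
Let le_link (A : nat -> {set T}) l N k a b w (p : R) :
  (1 <= p <= (2 * 2 ^ l)%:R)%R -> (l <= k < N)%N ->
  a \in A k -> b \in A k.+1 ->
  (z a b w <= 8 * sqrt2pow k * link_sum A l N w `^ p^-1)%R.
Proof.
move=> /andP[p1 pl] /[dup] kN /andP[lk _] aA bA.
have p0 : (0 < p)%R by exact: lt_le_trans p1.
have s0 : (0 < 8 * sqrt2pow k :> R)%R by rewrite mulr_gt0// sqrt2pow_gt0.
rewrite mulrC -ler_pdivrMr//; set y := (_ / _)%R.
have y0 : (0 <= y)%R by rewrite divr_ge0 ?z_ge0// ltW.
rewrite -[y](powRr1 y0) -(divff (lt0r_neq0 p0)) powRrM.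
apply: ge0_ler_powR; rewrite ?nnegrE ?powR_ge0 ?invr_ge0 ?(ltW p0)//.
  by apply: le_trans (link_sum_ge1 A l N w).
apply: le_trans (le_link_sum A l N k (a, b) w kN aA bA).
have pk : (0 <= p <= (2 * 2 ^ k)%:R)%R.
  by rewrite (ltW p0)/= (le_trans pl)// ler_nat leq_mul2l/= leq_exp2l.
apply: le_trans (powR_le_1D_expR _ _ _ y0 pk) _.
rewrite lerD2l /link/= ler_expR mulrBr mulr1 lerB// /y expr_div_n.
rewrite [((8 * _) ^+ 2)%R]exprMn.
rewrite sqr_sqrt2pow !natrM [leLHS](_ : _ = z a b w ^+ 2 / 16)%R//.
have : (0 < (2 ^ k)%:R :> R)%R by rewrite ltr0n expn_gt0.
by move=> t0; field; rewrite gt_eqF.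
Qed.

(** Level [k] has at most [2^(2^k) * 2^(2^(k+1)) = 8^(2^k)] links, each of integral at most
    [K * exp (- 4 * 2^k) <= K * 16^(- 2^k)], so it contributes at most
    [K * 2^(- 2^k) <= K * 2^-k]. *)
Let link_sum_integral (A : nat -> {set T}) l N : (forall k, #|A k| <= 2 ^ 2 ^ k)%N ->
  \int[P]_w (link_sum A l N w)%:E <= (1 + 2 * K)%:E.
Proof.
move=> cardA; have K0 : (0 <= K)%R by exact: le_trans K1.
under eq_integral do rewrite EFinD -sumEFin.
have mlink k x : measurable_fun setT (fun w => (link k x w)%:E : \bar R).
  by apply/measurable_EFinP; exact: mexpz.
have mlinks k : measurable_fun setT
    (fun w => (\sum_(x <- links A k) link k x w)%:E : \bar R).
  by apply/measurable_EFinP; apply: measurable_sum => x; exact: mexpz.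
have links0 k w : 0 <= (\sum_(x <- links A k) link k x w)%:E.
  by rewrite lee_fin sumr_ge0// => x _; exact: expR_ge0.
rewrite ge0_integralD//; last 2 first.
- by move=> w _; exact: sume_ge0.
- exact: emeasurable_sum.
rewrite EFinD; apply: leeD.
  by rewrite -[leLHS]/(\int[P]_w cst 1%:E w) integral_cst// mul1e probability_le1.
rewrite ge0_integral_sum//.
apply: (@le_trans _ _ (\sum_(l <= k < N) (2^-1 ^+ k * K)%:E)); last first.
  rewrite sumEFin lee_fin -mulr_suml ler_wpM2r//.
  apply: le_trans (sum_half_le2 N).
  have [lN|Nl] := leqP l N; last first.
    by rewrite big_geq ?(ltnW Nl)// sumr_ge0// => k _; rewrite exprn_ge0.
  by rewrite [leRHS](big_cat_nat (n := l))//= lerDr sumr_ge0// => k _;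
    rewrite exprn_ge0.
apply: lee_sum => k _.
under eq_integral do rewrite -sumEFin.
rewrite ge0_integral_sum//; last by move=> x w _; rewrite lee_fin expR_ge0.
apply: (@le_trans _ _ (\sum_(x <- links A k) (expR (- (4 * 2 ^ k)%:R) * K)%:E)).
  apply: lee_sum => x _; rewrite /link.
  under eq_integral do rewrite addrC expRD EFinM.
  rewrite ge0_integralZl_EFin ?expR_ge0//; last 1 first.
    apply/measurable_EFinP; under eq_fun do rewrite -[X in expR X]subr0.
    exact: mexpz.
  by rewrite EFinM lee_wpmul2l ?lee_fin ?expR_ge0// normalized_moment.
rewrite sumEFin lee_fin big_const_seq count_predT iter_addr_0 -cardE cardsX.
rewrite -[leLHS]mulr_natl mulrA ler_wpM2r//.
have cardAA : (#|A k| * #|A k.+1| <= 8 ^ 2 ^ k)%N.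
  apply: leq_trans (leq_mul (cardA k) (cardA k.+1)) _.
  by rewrite -expnD -[8%N]/(2 ^ 3)%N -expnM leq_exp2l// expnS -mulSn.
have e16 : (expR (- 4) <= 16^-1 :> R)%R.
  rewrite expRN lef_pV2 ?posrE ?expR_gt0// -[4%R]mulr1 expRM_natl.
  apply: le_trans (_ : 2 ^+ 4 <= _)%R; first by rewrite -natrX.
  by rewrite lerXn2r ?nnegrE ?expR_ge0// expR1_ge2.
apply: (@le_trans _ _ ((8 ^ 2 ^ k)%:R * 16^-1 ^+ (2 ^ k))%R).
  apply: ler_pM; rewrite ?ler_nat ?expR_ge0//.
  rewrite mulnC natrM -mulrN expRM_natl.
  by rewrite lerXn2r ?nnegrE ?expR_ge0.
rewrite natrX -exprMn (_ : 8 / 16 = 2^-1)%R; last by field.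
apply: ler_wiXn2l; rewrite ?invr_ge0// ?invf_le1 ?ler1n//.
by rewrite ltnW// ltn_expl.
Qed.

(** A distance is 0 as soon as its weight exceeds [S / d] for every positive value of [d]; there are
    finitely many values, and the sum of the [m x] is a level that works for all. *)
Let exists_projection_level (A : nat -> {set T}) (l : nat) (pi : nat -> T -> T)
    (S : R) :
  (forall n t, \sum_(l <= k < n) sqrt2pow k * d t (pi k t) <= S)%R ->
  exists2 N, (l <= N)%N & forall t, d t (pi N t) = 0%R.
Proof.
move=> dS.
have /choice[m mP] : forall x : T * T, exists n, (S / d x.1 x.2 < sqrt2pow n)%R.
  by move=> x; exact: sqrt2pow_unbounded.
pose N := (l + \sum_x m x)%N; exists N; first exact: leq_addr.
move=> t; apply/eqP; rewrite eq_le semi_metric_ge0 andbT leNgt; apply/negP => dt.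
have := dS N.+1 t; rewrite big_nat_recr ?leq_addr//= leNgt => /negP; apply.
apply: (@lt_le_trans _ _ (sqrt2pow N * d t (pi N t))%R); last first.
  rewrite lerDr sumr_ge0// => k _.
  by rewrite mulr_ge0 ?semi_metric_ge0// ltW// sqrt2pow_gt0.
rewrite -ltr_pdivrMr//; apply: lt_le_trans (mP (t, pi N t)) _.
rewrite le_sqrt2pow//; move: (t, pi N t) => x.
by apply: leq_trans (leq_addl _ _); rewrite (bigD1 x)//= leq_addr.
Qed.

Let chain_bound (l N : nat) (pi : nat -> T -> T) (t0 t : T) w : (l <= N)%N ->
  (rho t0 t w <= rho t0 (pi l t) w +
    \sum_(l <= k < N) rho (pi k t) (pi k.+1 t) w + rho (pi N t) t w)%R.
Proof.
move=> /subnK <-; elim: (N - l)%N => [|n IHn].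
  by rewrite add0n big_geq// addr0 rho_triangle.
rewrite addSn big_nat_recr ?leq_addl//=.
have := rho_triangle (pi (n + l)%N t) (pi (n + l).+1%N t) t w; lra.
Qed.

(** Both bounds tying [l] to [p] serve: [2^l <= p] gives [|A_l| <= 2^p] for the maximum over [A l],
    and [p <= 2 * 2^l] gives the link bound. *)
Lemma chaining_moment (A : nat -> {set T}) (l : nat) (pi : nat -> T -> T)
    (t0 : T) (p S M : R) :
  (forall k, #|A k| <= 2 ^ 2 ^ k)%N ->
  (1 <= p)%R -> ((2 ^ l)%:R <= p <= (2 * 2 ^ l)%:R)%R ->
  (forall k t, (l <= k)%N -> pi k t \in A k) ->
  (forall n t, \sum_(l <= k < n) sqrt2pow k * d t (pi k t) <= S)%R ->
  (0 <= M)%R -> (forall t, 'N[P]_p%:E[EFin \o rho t0 t] <= M%:E) ->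
  'N[P]_p%:E[EFin \o (fun w => \big[Num.max/0%R]_t rho t0 t w)]
    <= (16 * (1 + 2 * K) * S + 2 * M)%:E.
Proof.
move=> cardA p1 /andP[lp pl] piA dS M0 rhoM.
have [_ dC dT] := d_semi.
have p0 : (0 < p)%R by exact: lt_le_trans p1.
have [N lN dN] := exists_projection_level A l pi S dS.
have S0 : (0 <= S)%R by have := dS l t0; rewrite big_geq.
pose W w := (link_sum A l N w `^ p^-1)%R.
have W0 w : (0 <= W w)%R by rewrite powR_ge0.
have mW : measurable_fun setT W.
  exact: (measurableT_comp (f := fun x : R => (x `^ p^-1)%R)).
pose m w := \big[Num.max/0%R]_(t in A l) rho t0 t w.
have mm : measurable_fun setT m by exact: measurable_bigmaxr.
have m0 w : (0 <= m w)%R by exact: bigmaxr_ge0.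
(* A link is compared with the distances from [t] to its two ends; the second gets the larger weight
   of level [k + 1], so that both match terms of the sum bounded by [S]. *)
have link_le w k t : (forall s t, rho s t w <= d s t * z s t w)%R -> (l <= k < N)%N ->
    (rho (pi k t) (pi k.+1 t) w <= 8 * W w *
      (sqrt2pow k * d t (pi k t) + sqrt2pow k.+1 * d t (pi k.+1 t)))%R.
  move=> rz /[dup] kN /andP[lk _]; apply: le_trans (rz _ _) _.
  have s0 := @sqrt2pow_gt0 R k.
  have s1 : (sqrt2pow k <= sqrt2pow k.+1 :> R)%R by exact: le_sqrt2pow.
  have d0 := semi_metric_ge0 t (pi k t).
  have d1 := semi_metric_ge0 t (pi k.+1 t).
  have dd : (d (pi k t) (pi k.+1 t) <= d t (pi k t) + d t (pi k.+1 t))%R.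
    by rewrite (dC t (pi k t)) dT.
  have := @le_link A l N k (pi k t) (pi k.+1 t) w p.
  rewrite p1 pl => /(_ isT kN (piA _ _ lk) (piA _ _ (leqW lk))) zW.
  apply: (@le_trans _ _ ((d t (pi k t) + d t (pi k.+1 t)) * (8 * sqrt2pow k * W w)))%R.
    by apply: ler_pM; rewrite ?semi_metric_ge0 ?z_ge0.
  rewrite [leLHS](_ : _ = 8 * W w *
    (sqrt2pow k * d t (pi k t) + sqrt2pow k * d t (pi k.+1 t)))%R; last by ring.
  by rewrite ler_wpM2l ?mulr_ge0// lerD2l ler_wpM2r.
have ae_le : {ae P, forall w, `|\big[Num.max/0%R]_t rho t0 t w| <=
    `|(m \+ (fun w => 16 * S * W w)) w| }%R.
  (* There are finitely many pairs, so one null set serves them all. *)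
  have : {ae P, forall w, forall x : T * T, rho x.1 x.2 w <= d x.1 x.2 * z x.1 x.2 w}%R.
    by apply: filter_forall => x; exact: rho_le_normalized.
  apply: filterS => w rz'.
  have rz s t : (rho s t w <= d s t * z s t w)%R := rz' (s, t).
  have SW0 : (0 <= 16 * S * W w)%R by rewrite !mulr_ge0.
  rewrite ger0_norm ?bigmaxr_ge0// ger0_norm ?addr_ge0//=.
  apply: bigmax_le => [|t _]; first by rewrite addr_ge0.
  apply: le_trans (chain_bound l N pi t0 t w lN) _.
  have rN : (rho (pi N t) t w <= 0)%R by rewrite (le_trans (rz _ _))// dC dN mul0r.
  have rl : (rho t0 (pi l t) w <= m w)%R.
    exact: (le_bigmax_cond _ (fun t => rho t0 t w) (piA _ _ (leqnn l))).
  suff : (\sum_(l <= k < N) rho (pi k t) (pi k.+1 t) w <= 16 * S * W w)%R by lra.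
  apply: (@le_trans _ _ (\sum_(l <= k < N) 8 * W w *
      (sqrt2pow k * d t (pi k t) + sqrt2pow k.+1 * d t (pi k.+1 t))))%R.
    by rewrite !big_nat; apply: ler_sum => k kN; exact: link_le.
  rewrite -mulr_sumr big_split/=.
  (* Each of the two sums is at most [S], the second after an index shift up to [N + 1]; hence 16 =
     8 + 8. *)
  have S1 := dS N t.
  have S2 : (\sum_(l <= k < N) sqrt2pow k.+1 * d t (pi k.+1 t) <= S)%R.
    apply: le_trans (dS N.+1 t); rewrite big_nat_recl//= lerDr.
    by rewrite mulr_ge0 ?semi_metric_ge0// ltW// sqrt2pow_gt0.
  have := W0 w; nra.
have m16W : measurable_fun setT (fun w => 16 * S * W w)%R.
  exact: measurable_funM.
apply: le_trans (@ae_le_Lnorm _ _ _ P _ _ p _ _ p0 ae_le) _.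
- exact: measurable_bigmaxr.
- exact: measurable_funD.
apply: le_trans (minkowski_EFin P mm m16W p1) _.
rewrite addeC EFinD; apply: leeD.
  rewrite (mulrAC 16%R).
  have K21 : (1 <= 1 + 2 * K)%R by have := K1; lra.
  apply: (@Lnorm_le_dominated _ _ _ _ _ (link_sum A l N)) => //.
  - by move=> w; exact: le_trans (link_sum_ge1 A l N w).
  - by rewrite mulr_ge0.
  - apply: nearW => w; rewrite ger0_norm ?mulr_ge0//.
    rewrite powRM ?mulr_ge0// /W -powRrM mulVf ?gt_eqF// powRr1//.
    exact: le_trans (link_sum_ge1 A l N w).
  - exact: link_sum_integral.
apply: Lnorm_bigmax => //.
apply: (@le_trans _ _ ((2 ^ 2 ^ l)%:R)); first by rewrite ler_nat.
by rewrite natrX -powR_mulrn// ler_powR// ler1n.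
Qed.

Let dE s t := (d s t)%:E.

Let sup_rhoE t0 : (fun w => ereal_sup (range (fun t => (rho t0 t w)%:E))) =
  EFin \o (fun w => \big[Num.max/0%R]_t rho t0 t w).
Proof. by apply/funext => w; apply: (ereal_sup_range_bigmax _ t0). Qed.

Lemma chaining_Lnorm (p : R) (t0 : T) : (1 <= p)%R ->
  'N[P]_p%:E[(fun w => ereal_sup (range (fun t => (rho t0 t w)%:E)))] <=
    chaining_cst%:E * gamma2p p dE +
    2%:E * ereal_sup (range (fun t => 'N[P]_p%:E[(fun w => (rho t0 t w)%:E)])).
Proof.
move=> p1; rewrite sup_rhoE; set X := ereal_sup _.
have d0 := semi_metric_ge0.
have dE_ge0 s t : 0 <= dE s t by rewrite lee_fin.
have C0 : (0 < chaining_cst :> R)%R by exact: chaining_cst_gt0.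
have rhoX t : 'N[P]_p%:E[EFin \o rho t0 t] <= X by apply: ereal_sup_ubound; exists t.
have X0 : 0 <= X by exact: le_trans (Lnorm_ge0 _ _ _) (rhoX t0).
have gam0 : 0 <= gamma2p p dE by exact: gamma2_from_ge0.
have [Xy|Xy] := eqVneq X +oo.
  rewrite Xy gt0_muley// addey ?leey// gt_eqF// (lt_le_trans ltNy0)//.
  by rewrite mule_ge0// lee_fin ltW.
have /fineK XM : X \is a fin_num by rewrite ge0_fin_numE// ltey.
have M0 : (0 <= fine X)%R by rewrite fine_ge0.
(* Solving for the infimum [gamma2p] allows one admissible sequence to be treated at a time. *)
rewrite -XM -EFinM -leeBlDr// -lee_pdivrMl//.
apply: le_ereal_inf_tmp => _ [A [A0 cardA] <-].
rewrite lee_pdivrMl// leeBlDr//; set G := ereal_sup _.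
have [Gy|Gy] := eqVneq G +oo.
  by rewrite Gy gt0_muley ?lte_fin// addye// leey.
have AG t : \sum_(Num.truncn (ln p / ln 2) <= k <oo)
    (2 `^ (k%:R / 2))%:E * dist_to_set dE t (A k) <= G.
  by apply: ereal_sup_ubound; exists t.
have G0 : 0 <= G.
  apply: le_trans (AG t0); apply: nneseries_ge0 => k _ _.
  exact: gamma2_from_term_ge0.
have /fineK GS : G \is a fin_num by rewrite ge0_fin_numE// ltey.
rewrite -GS in AG *.
have [pi [piA piS]] := projection_sequence d _ _ t0 _ d0 AG.
rewrite -EFinM -EFinD.
apply: (@chaining_moment A _ pi) => //; last by move=> t; rewrite XM.
(* At level 0 the single point is within the bound [2^(2^0) = 2]. *)
- by case=> [|k]; rewrite ?A0// cardA.
- exact: truncn_log2_itv.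
- exact: piA.
Qed.

Lemma chaining_tail (t0 : T) (u : R) : 0 < diameter dE -> (1 <= u)%R ->
  P [set w | (Num.sqrt (expR 1))%:E *
       (chaining_cst%:E * gamma2 dE + u%:E * diameter_cst%:E * diameter dE)
     <= ereal_sup (range (fun t => (rho t0 t w)%:E))] <= (expR (- (u ^+ 2 / 2)))%:E.
Proof.
pose supY w := ereal_sup (range (fun t => (rho t0 t w)%:E)).
rewrite -[X in P X]/[set w | _ <= supY w].
have supYE : supY = EFin \o (fun w => \big[Num.max/0%R]_t rho t0 t w) := sup_rhoE t0.
move=> diam0 u1; set B := _ + _.
have u0 : (0 < u)%R by exact: lt_le_trans u1.
have d0 := semi_metric_ge0.
have dE_ge0 s t : 0 <= dE s t by rewrite lee_fin.
have D0 : (0 < diameter_cst :> R)%R by exact: diameter_cst_gt0.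
have gam0 : 0 <= gamma2 dE by exact: gamma2_from_ge0.
(* The positive diameter makes [B] positive, so Markov's inequality can be divided by a power of
   [B]. *)
have B0 : 0 < B.
  apply: (@lt_le_trans _ _ (u%:E * diameter_cst%:E * diameter dE)).
    by rewrite !mule_gt0// lte_fin.
  by rewrite leeDr// mule_ge0// lee_fin ltW// chaining_cst_gt0.
have e0 : (0 < Num.sqrt (expR 1) :> R)%R by rewrite sqrtr_gt0 expR_gt0.
have [By|By] := eqVneq B +oo.
  rewrite By [X in P X](_ : _ = set0) ?measure0 ?lee_fin ?expR_ge0//.
  apply/seteqP; split => // w /=.
  by rewrite gt0_muley ?lte_fin// supYE/= leye_eq.
have p1 : (1 <= u ^+ 2)%R by rewrite exprn_ege1.
have p0 : (0 < u ^+ 2)%R by rewrite exprn_gt0.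
(* Here [gamma2p] is at most [gamma2], and the one-point term is at most [2 * (3 * u * K)] times the
   diameter. *)
have NB : 'N[P]_(u ^+ 2)%:E[supY] <= B.
  apply: le_trans (chaining_Lnorm _ t0 p1) _; apply: leeD.
    by rewrite lee_wpmul2l ?lee_fin ?(ltW chaining_cst_gt0)// gamma2_from_le.
  apply: (@le_trans _ _ (2%:E * ((3 * u * K)%:E * diameter dE))).
    rewrite lee_wpmul2l//; apply: ge_ereal_sup => _ [t _ <-].
    apply: le_trans (Lnorm_rho t0 t u u1) _.
    rewrite -mulrA [(_ * K)%R]mulrC mulrA EFinM lee_wpmul2l//.
      by rewrite lee_fin !mulr_ge0 ?(ltW u0)// (le_trans _ K1).
    by apply: ereal_sup_ubound; exists (t0, t).
  rewrite muleA -!EFinM (_ : 2 * (3 * u * K) = u * diameter_cst)%R//.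
  by rewrite /diameter_cst -/K; ring.
have /fineK Bb : B \is a fin_num by rewrite ge0_fin_numE ?ltey// ltW.
have b0 : (0 < fine B)%R by rewrite -lte_fin Bb.
pose g w := (`|\big[Num.max/0%R]_t rho t0 t w| `^ (u ^+ 2))%R.
have mg : measurable_fun setT g.
  by apply/measurable_EFinP; apply: measurable_powR_norm; exact: measurable_bigmaxr.
have gB : \int[P]_w (g w)%:E <= (fine B `^ (u ^+ 2))%:E.
  have -> : \int[P]_w (g w)%:E = \int[P]_w `|supY w| `^ (u ^+ 2).
    by apply: eq_integral => w _; rewrite supYE.
  rewrite -poweR_Lnorm ?gt_eqF// -poweR_EFin Bb.
  by apply: (gt0_ler_poweR (ltW p0));
    rewrite ?in_itv/= ?leey ?andbT ?Lnorm_ge0 ?(ltW B0).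
have a0 : (0 <= (Num.sqrt (expR 1) * fine B) `^ (u ^+ 2))%R by rewrite powR_ge0.
have := le_trans (markov_ge0 _ _ _ P _ _ mg (fun w => powR_ge0 _ _) a0) gB.
have -> : [set w | (Num.sqrt (expR 1) * fine B) `^ (u ^+ 2) <= g w]%R =
    [set w | (Num.sqrt (expR 1))%:E * B <= supY w].
  apply/seteqP; split => w /=; rewrite -Bb -EFinM supYE/= lee_fin /g.
    have bm0 : (0 <= \big[Num.max/0%R]_t rho t0 t w)%R by exact: bigmaxr_ge0.
    rewrite (ger0_norm bm0) => h; rewrite leNgt; apply/negP => lt.
    move: h; rewrite leNgt => /negP; apply.
    by apply: (gt0_ltr_powR p0); rewrite ?nnegrE ?mulr_ge0 ?(ltW e0) ?(ltW b0).
  move=> h; have bm0 := le_trans (mulr_ge0 (ltW e0) (ltW b0)) h.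
  rewrite (ger0_norm bm0); apply: (ge0_ler_powR (ltW p0)); rewrite ?nnegrE//.
  by rewrite mulr_ge0 ?(ltW e0) ?(ltW b0).
rewrite powRM ?(ltW e0) ?(ltW b0)// mulrC EFinM -muleA.
rewrite -[leRHS]mule1 lee_pmul2l ?lte_fin ?powR_gt0//.
rewrite -lee_pdivlMl ?powR_gt0// mule1 => /le_trans; apply.
(* The power [u^2] of [sqrt e] is [exp (u^2 / 2)]. *)
rewrite lee_fin -powR12_sqrt ?expR_ge0// -powRrM -expRM -expRN ler_expR; lra.
Qed.
End subgaussian_semimetric.

(** Norms of increments form a random semi-metric, and [exp (- u^2) <= exp (- u^2 / 8)]. *)
Lemma psi2_chaining {R : realType} :
  @psi2_chaining_bound R chaining_cst diameter_cst.
Proof.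
move=> disp Om P V T d Y d_semi mY tailY dE t0 supY.
have [_ dC _] := d_semi; pose rho (s t : T) (w : Om) : R := `|Y t w - Y s w|%R.
have rho_ge0 s t w : (0 <= rho s t w)%R by exact: normr_ge0.
have rho_triangle r s t w : (rho r t w <= rho r s w + rho s t w)%R.
  by rewrite addrC; exact: ler_distD.
have rho_tail s t (u : R) : (0 <= u)%R ->
    P [set w | (u * d s t < rho s t w)%R] <= (2 * expR (- (u ^+ 2 / 8)))%:E.
  move=> u0; apply: (@le_trans _ _ (2 * expR (- u ^+ 2))%:E).
    by rewrite (dC s t); exact: tailY.
  by rewrite lee_fin ler_wpM2l// ler_expR lerN2; have := sqr_ge0 u; lra.
split => [p p1|diam0 u u1].
  exact: (@chaining_Lnorm _ _ _ P T d rho).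
exact: (@chaining_tail _ _ _ P T d rho).
Qed.

(** * Azuma's inequality *)

(** For [x > 1/2], [x <= 2 * x^2] and [cosh x <= exp x]. Otherwise quadratic bounds on [exp x] and
    [exp (- x)] average to [1 + 3/2 * x^2], below [1 + 2 * x^2]. *)
Lemma cosh_le_expR {R : realType} (x : R) : (0 <= x)%R ->
  ((expR x + expR (- x)) / 2 <= expR (2 * x ^+ 2))%R.
Proof.
move=> x0; have [x12|x12] := leP x 2^-1%R; last first.
  have e1 : (expR (- x) <= expR x)%R by rewrite ler_expR; lra.
  have e2 : (expR x <= expR (2 * x ^+ 2))%R by rewrite ler_expR; nra.
  lra.
have e1 := @expR_ge1Dx R (- x); have e2 := @expR_ge1Dx R x.
have e3 := @expR_ge1Dx R (2 * x ^+ 2).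
have ee : (expR x * expR (- x) = 1)%R by rewrite -expRD subrr expR0.
have f0 := expR_gt0 x; have f1 := expR_gt0 (- x).
(* Multiplied by [exp (- x) >= 1 - x], the right side is at least [1 + x^2 - 2 * x^3], which is at
   least 1 as [x <= 1/2]. *)
have e4 : (expR x <= 1 + x + 2 * x ^+ 2)%R.
  rewrite -(ler_pM2r f1) ee.
  apply: (@le_trans _ _ ((1 + x + 2 * x ^+ 2) * (1 - x)))%R; first nra.
  by rewrite ler_wpM2l//; nra.
have e5 : (expR (- x) <= 1 - x + x ^+ 2)%R.
  rewrite -(ler_pM2l f0) ee.
  apply: (@le_trans _ _ ((1 + x) * (1 - x + x ^+ 2)))%R; first nra.
  by rewrite ler_wpM2r//; nra.
nra.
Qed.

(* The chord of the exponential over [-a, a]; when [c = 0], [2 * c] inverts to [0]. *)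
Lemma expR_le_chord {R : realType} (l c x : R) : (0 <= l)%R -> (`|x| <= c)%R ->
  (expR (l * x) <= expR (- (l * c)) +
     (expR (l * c) - expR (- (l * c))) / (2 * c) * Num.max 0 (x + c))%R.
Proof.
move=> l0 xc; have c0 : (0 <= c)%R by exact: le_trans xc.
have /andP[cx cx'] : (- c <= x <= c)%R by rewrite -ler_norml.
rewrite max_r; last lra.
move: c0; rewrite le_eqVlt => /predU1P[c0|c0].
  have -> : x = 0%R by lra.
  by rewrite -c0 !(mulr0, mul0r, invr0, oppr0, addr0).
have t01 : (0 <= (c - x) / (2 * c) <= 1)%R.
  by rewrite divr_ge0 ?ler_pdivrMr//; lra.
have [t tE] : exists t : {i01 R}, t%:num%R = ((c - x) / (2 * c))%R.
  case/andP: t01 => ta tb.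
  by exists (Itv01 ta tb).
have := @convex_expR R t (- (l * c))%R (l * c)%R.
rewrite !convRE tE /unstable.onem.
rewrite (_ : (c - x) / (2 * c) * - (l * c) +
  (1 - (c - x) / (2 * c)) * (l * c) = l * x)%R; last first.
  by field; rewrite gt_eqF.
move=> /le_trans; apply; rewrite le_eqVlt; apply/orP; left; apply/eqP.
by field; rewrite gt_eqF.
Qed.

(** * Functions measurable for a sub-sigma-algebra, and integrals against them *)

Section sub_sigma_algebra.
Context {d} {Om : measurableType d} {R : realType} (P : probability Om R).
Context (G : set (set Om)).
Hypothesis GsG : Defs.sub_sigma_algebra G.

(** A sigma-algebra is the one it generates; this transfers the closure properties of measurable
    functions to [measurable_wrt]. *)
Lemma measurable_wrtP (f : Om -> R) : measurable_wrt G f <->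
  measurable_fun (setT : set (g_sigma_algebraType G)) (f : g_sigma_algebraType G -> R).
Proof.
have GE : <<s G>> = G by exact: sigma_algebra_id GsG.1.
split => mf.
  move=> _ B mB; rewrite setTI; rewrite /measurable/= GE; exact: mf.
move=> B mB; have := mf measurableT B mB; rewrite setTI.
by rewrite /measurable/= GE.
Qed.

Lemma measurable_wrtW (f : Om -> R) : measurable_wrt G f -> measurable_fun setT f.
Proof. by move=> mf _ B mB; rewrite setTI; apply: GsG.2; exact: mf. Qed.

Lemma measurable_wrtB (f g : Om -> R) :
  measurable_wrt G f -> measurable_wrt G g ->
  measurable_wrt G (fun w => f w - g w)%R.
Proof.
move=> /measurable_wrtP mf /measurable_wrtP mg; apply/measurable_wrtP.
exact: measurable_funB.
Qed.

Lemma measurable_wrt_expR (f : Om -> R) (l : R) :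
  measurable_wrt G f -> measurable_wrt G (fun w => expR (l * f w))%R.
Proof.
move=> /measurable_wrtP mf; apply/measurable_wrtP.
by apply: measurableT_comp => //; exact: measurable_funM.
Qed.

Import HBNNSimple.

Section same_integrals.
Context (f1 f2 : Om -> R).
Hypothesis mf1 : measurable_fun setT f1.
Hypothesis mf2 : measurable_fun setT f2.
Hypothesis f1_ge0 : forall w, (0 <= f1 w)%R.
Hypothesis f2_ge0 : forall w, (0 <= f2 w)%R.
Hypothesis f12 : forall A, G A ->
  \int[P]_(w in A) (f1 w)%:E = \int[P]_(w in A) (f2 w)%:E.

Let indic_same (a : R) (A : set Om) : (0 <= a)%R -> G A ->
  \int[P]_w ((a * \1_A w)%:E * (f1 w)%:E) = \int[P]_w ((a * \1_A w)%:E * (f2 w)%:E).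
Proof.
move=> a0 GA; have mA := GsG.2 _ GA.
have aux (f : Om -> R) : measurable_fun setT f -> (forall w, 0 <= f w)%R ->
    \int[P]_w ((a * \1_A w)%:E * (f w)%:E) = a%:E * \int[P]_(w in A) (f w)%:E.
  move=> mf f0; under eq_integral do rewrite EFinM -muleA.
  rewrite ge0_integralZl_EFin//; last 2 first.
  - by move=> w _; rewrite mule_ge0// lee_fin.
  - by apply: emeasurable_funM; apply/measurable_EFinP => //; exact: measurable_indic.
  congr (_ * _); rewrite [RHS]integral_mkcond epatch_indic.
  by apply: eq_integral => w _; rewrite muleC.
by rewrite !aux// f12.
Qed.

(** The dyadic approximations of [g] are combinations of indicators of preimages of intervals under
    [g], and these preimages lie in [G]. *)
Lemma eq_integral_mul_approx (g : Om -> R) n : measurable_wrt G g ->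
  \int[P]_w ((approx setT (EFin \o g) n w)%:E * (f1 w)%:E) =
  \int[P]_w ((approx setT (EFin \o g) n w)%:E * (f2 w)%:E).
Proof.
move=> mg; have [G0 _ _] := GsG.1.
pose A k := dyadic_approx setT (EFin \o g) n k.
pose B := integer_approx setT (EFin \o g) n.
have GA k : G (A k).
  rewrite /A /dyadic_approx; case: ifPn => // _.
  rewrite setTI (_ : [set _ | _] = g @^-1` [set` dyadic_itv R n k]).
    by apply: mg; exact: measurable_itv.
  apply/seteqP; split => w /=; rewrite inE/=.
    by move=> [r rI [<-]].
  by move=> gI; exists (g w).
have GB : G B.
  rewrite /B /integer_approx setTI (_ : [set _ | _] = g @^-1` `[n%:R, +oo[%classic).
    by apply: mg; exact: measurable_itv.
  by apply/seteqP; split => w /=; rewrite lee_fin in_itv/= andbT.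
have mG S : G S -> measurable S by exact: GsG.2.
pose a k : R := (k%:R * 2 ^- n)%R.
have a0 k : (0 <= a k)%R by rewrite mulr_ge0// invr_ge0 exprn_ge0.
have aux (f : Om -> R) : measurable_fun setT f -> (forall w, 0 <= f w)%R ->
    \int[P]_w ((approx setT (EFin \o g) n w)%:E * (f w)%:E) =
    \sum_(k <- index_enum 'I_(n * 2 ^ n)) \int[P]_w ((a k * \1_(A k) w)%:E * (f w)%:E) +
    \int[P]_w ((n%:R * \1_B w)%:E * (f w)%:E).
  move=> mf f0.
  have mterm (c : R) S : G S ->
      measurable_fun setT (fun w => (c * \1_S w)%:E * (f w)%:E).
    move=> GS; apply: emeasurable_funM; apply/measurable_EFinP => //.
    by apply: measurable_funM => //; apply: measurable_indic; exact: mG.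
  have term0 (c : R) S w : (0 <= c)%R -> 0 <= (c * \1_S w)%:E * (f w)%:E.
    by move=> c0; rewrite mule_ge0 ?lee_fin ?mulr_ge0.
  rewrite -ge0_integral_sum//; last 2 first.
  - by move=> k; exact: mterm.
  - by move=> k w _; exact: term0.
  rewrite -ge0_integralD//; last 4 first.
  - by move=> w _; rewrite sume_ge0// => k _; exact: term0.
  - by apply: emeasurable_sum => k; exact: mterm.
  - by move=> w _; exact: term0.
  - exact: mterm.
  apply: eq_integral => w _; rewrite /approx EFinD ge0_muleDl; last 2 first.
  - by rewrite lee_fin sumr_ge0// => k _; rewrite mulr_ge0.
  - by rewrite lee_fin mulr_ge0.
  by rewrite -sumEFin ge0_sume_distrl// => k _; rewrite lee_fin mulr_ge0.
rewrite !aux//; congr (_ + _); last exact: indic_same.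
by apply: eq_bigr => k _; exact: indic_same.
Qed.

(** This takes a [G]-measurable factor out of a conditional expectation, by monotone convergence
    along the dyadic approximations. *)
Lemma eq_integral_mul (g : Om -> R) : measurable_wrt G g -> (forall w, 0 <= g w)%R ->
  \int[P]_w ((g w)%:E * (f1 w)%:E) = \int[P]_w ((g w)%:E * (f2 w)%:E).
Proof.
move=> mg g0.
have aux (f : Om -> R) : measurable_fun setT f -> (forall w, 0 <= f w)%R ->
    \int[P]_w ((g w)%:E * (f w)%:E) =
    limn (fun n => \int[P]_w ((approx setT (EFin \o g) n w)%:E * (f w)%:E)).
  move=> mf f0.
  have ap0 n w : 0 <= (approx setT (EFin \o g) n w)%:E :> \bar R.
    rewrite lee_fin /approx; apply: addr_ge0; last by rewrite mulr_ge0.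
    by apply: sumr_ge0 => k _; rewrite mulr_ge0.
  have mEg : measurable_fun setT (EFin \o g).
    by apply/measurable_EFinP; exact: measurable_wrtW.
  rewrite -monotone_convergence//; last 3 first.
  - move=> n; apply: emeasurable_funM; last exact/measurable_EFinP.
    rewrite -(nnsfun_approxE measurableT mEg); apply/measurable_EFinP.
    exact: (@measurable_funPT _ _ _ _ (nnsfun_approx measurableT mEg n)).
  - by move=> n w _; rewrite mule_ge0 ?ap0 ?lee_fin.
  - move=> w _ m n mn; rewrite lee_wpmul2r ?lee_fin//.
    exact: (lefP _ _ (nd_approx setT (EFin \o g) mn) w).
  apply: eq_integral => w _; apply/esym/cvg_lim => //.
  have g0E x : [set: Om] x -> 0 <= (EFin \o g) x by rewrite /= lee_fin.
  by apply: cvgeZr => //; exact: (@ecvg_approx _ _ _ setT (EFin \o g) g0E w I).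
rewrite !aux//; congr (limn _); apply/funext => n.
exact: eq_integral_mul_approx.
Qed.

End same_integrals.
End sub_sigma_algebra.

(** * Exponential moments of a martingale and the one-sided tail *)

Section martingale_facts.
Context {d} {Om : measurableType d} {R : realType} (P : probability Om R).
Context (n : nat) (F : nat -> set (set Om)).
Hypothesis FF : filtration n F.

Let integrable_sub (A : set Om) (f : Om -> R) : measurable A ->
  P.-integrable setT (EFin \o f) -> P.-integrable A (EFin \o f).
Proof. by move=> mA; exact: integrableS. Qed.

Lemma martingaleB (X Y : nat -> Om -> R) :
  martingale P n F X -> martingale P n F Y ->
  martingale P n F (fun j w => X j w - Y j w)%R.
Proof.
move=> [aX mX] [aY mY].
have intB k : (k <= n)%N -> P.-integrable setT (EFin \o (fun w => X k w - Y k w)%R).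
  move=> kn; have [_ iX] := aX k kn; have [_ iY] := aY k kn.
  exact: (integrableB measurableT iX iY).
have mesB k : (k <= n)%N -> measurable_wrt (F k) (fun w => X k w - Y k w)%R.
  move=> kn; have [FX _] := aX k kn; have [FY _] := aY k kn.
  exact: measurable_wrtB (FF.1 k kn) _ _ FX FY.
split => [k kn|k kn]; first by split; [exact: mesB|exact: intB].
split; [exact/mesB/ltnW|exact/intB/ltnW|move=> A FA].
have mA : measurable A by apply: (FF.1 k (ltnW kn)).2.
have [_ _ EX] := mX k kn; have [_ _ EY] := mY k kn.
under eq_integral do rewrite EFinB.
under [RHS]eq_integral do rewrite EFinB.
rewrite !integralB_EFin ?EX ?EY//; apply: integrable_sub => //.
- by have [] := aX k.+1 kn.
- by have [] := aY k.+1 kn.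
- by have [] := aX k (ltnW kn).
- by have [] := aY k (ltnW kn).
Qed.

Context (M : nat -> Om -> R) (c : nat -> R).
Hypothesis martM : martingale P n F M.
Hypothesis c_ge0 : forall k, (0 <= c k)%R.
Hypothesis diff_le : forall k, (1 <= k <= n)%N ->
  {ae P, forall w, `|difference k M w| <= c k}%R.

Let mesM k : (k <= n)%N -> measurable_fun setT (M k).
Proof.
by move=> kn; have [FM _] := martM.1 k kn; exact: measurable_wrtW (FF.1 k kn) _ FM.
Qed.

Let increment_wrt k : (k <= n)%N -> measurable_wrt (F k) (fun w => M k w - M 0%N w)%R.
Proof.
move=> kn; apply: measurable_wrtB (FF.1 k kn) _ _ (martM.1 k kn).1 _.
move=> B mB; apply: (FF.2 0%N k); first by rewrite leq0n.
exact: (martM.1 0%N (leq0n n)).1.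
Qed.

(** The difference has conditional mean 0. The maximum with 0 makes the integrand nonnegative
    everywhere, as [eq_integral_mul] requires, and changes it only on a null set. *)
Let integral_difference k (A : set Om) : (k < n)%N -> F k A ->
  \int[P]_(w in A) (Num.max 0 (difference k.+1 M w + c k.+1))%:E =
  \int[P]_(w in A) (c k.+1)%:E.
Proof.
move=> kn FA; have mA : measurable A by apply: (FF.1 k (ltnW kn)).2.
have iM j : (j <= n)%N -> P.-integrable A (EFin \o M j).
  by move=> jn; apply: integrable_sub => //; have [] := martM.1 j jn.
have mD : measurable_fun setT (difference k.+1 M).
  by apply: measurable_funB; apply: mesM => //; exact: ltnW.
transitivity (\int[P]_(w in A) ((difference k.+1 M w)%:E + (c k.+1)%:E)).
  apply: ae_eq_integral => //.
  - apply/measurable_EFinP; apply: measurable_funTS.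
    by apply: measurable_maxr => //; exact: measurable_funD.
  - apply: emeasurable_funD => //; apply/measurable_EFinP.
    exact: measurable_funTS.
  - apply: filterS (diff_le k.+1 _) => // w Dc _.
    rewrite max_r ?EFinD//; move: Dc; rewrite ler_norml => /andP[]; lra.
have iD : P.-integrable A (EFin \o difference k.+1 M).
  by apply: (integrableB mA (iM _ kn) (iM _ (ltnW kn))).
rewrite (integralD_EFin mA iD); last exact: finite_measure_integrable_cst.
rewrite [X in X + _](_ : _ = 0) ?add0e//.
rewrite /difference /=; under eq_integral do rewrite EFinB.
rewrite integralB_EFin//; [|exact: iM|exact/iM/ltnW].
have [_ _ ->//] := martM.2 k kn.
rewrite subee//; apply: integrable_fin_num => //; exact: iM.
Qed.

(** In the inductive step the chord bound on [exp (l * difference)] is affine in the difference, so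
    conditioning on [F k] leaves the factor [cosh (l * c)], at most [exp (2 * l^2 * c^2)]. *)
Lemma martingale_mgf (l : R) k : (0 <= l)%R -> (k <= n)%N ->
  \int[P]_w (expR (l * (M k w - M 0%N w)))%:E <=
  (expR (2 * l ^+ 2 * \sum_(1 <= j < k.+1) c j ^+ 2))%:E.
Proof.
move=> l0; elim: k => [|k IHk] kn.
  rewrite big_geq// mulr0 expR0.
  under eq_integral do rewrite subrr mulr0 expR0.
  by rewrite -[leLHS]/(\int[P]_w cst 1%:E w) integral_cst// mul1e probability_le1.
have {}IHk := IHk (ltnW kn).
pose E w := expR (l * (M k w - M 0%N w)).
pose D w := Num.max 0%R (difference k.+1 M w + c k.+1)%R.
pose a := expR (- (l * c k.+1)).
pose b := ((expR (l * c k.+1) - expR (- (l * c k.+1))) / (2 * c k.+1))%R.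
have a0 : (0 <= a)%R by exact: expR_ge0.
have lc0 : (0 <= l * c k.+1)%R by rewrite mulr_ge0.
have b0 : (0 <= b)%R.
  by rewrite divr_ge0 ?mulr_ge0// subr_ge0 ler_expR; lra.
have E0 w : (0 <= E w)%R by exact: expR_ge0.
have D0 w : (0 <= D w)%R by rewrite le_max lexx.
have FE : measurable_wrt (F k) E.
  exact: measurable_wrt_expR (FF.1 k (ltnW kn)) _ _ (increment_wrt k (ltnW kn)).
have mE : measurable_fun setT E by exact: measurable_wrtW (FF.1 k (ltnW kn)) _ FE.
have mD : measurable_fun setT D.
  apply: measurable_maxr => //; apply: measurable_funD => //.
  by apply: measurable_funB; apply: mesM => //; exact: ltnW.
apply: (@le_trans _ _ (\int[P]_w (a%:E * (E w)%:E + b%:E * ((E w)%:E * (D w)%:E)))).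
  apply: ae_ge0_le_integral => //.
  - apply/measurable_EFinP; apply: measurableT_comp => //.
    apply: measurable_funM => //; apply: measurable_funB; exact: mesM.
  - by move=> w _; rewrite adde_ge0// !mule_ge0// lee_fin.
  - apply: emeasurable_funD; apply: measurable_funeM; last apply: emeasurable_funM;
      exact/measurable_EFinP.
  - apply: filterS (diff_le k.+1 _) => // w Dc _.
    rewrite -!EFinM -EFinD lee_fin.
    have -> : (l * (M k.+1 w - M 0%N w) =
        l * (M k w - M 0%N w) + l * difference k.+1 M w)%R.
      by rewrite /difference/=; ring.
    rewrite expRD -/(E w).
    rewrite (_ : a * E w + b * (E w * D w) = E w * (a + b * D w))%R; last by ring.
    by rewrite ler_wpM2l//; exact: expR_le_chord.
rewrite ge0_integralD//; last 4 first.
- by move=> w _; rewrite mule_ge0// lee_fin.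
- by apply: measurable_funeM; exact/measurable_EFinP.
- by move=> w _; rewrite !mule_ge0// lee_fin.
- by apply: measurable_funeM; apply: emeasurable_funM; exact/measurable_EFinP.
rewrite !ge0_integralZl_EFin//; last 4 first.
- by move=> w _; rewrite mule_ge0// lee_fin.
- by apply: emeasurable_funM; exact/measurable_EFinP.
- by move=> w _; rewrite lee_fin.
- exact/measurable_EFinP.
have ck_ge0 (w : Om) : (0 <= cst (c k.+1) w)%R by exact: c_ge0.
(* The weight [E] is [F k]-measurable, so [D] may be replaced by the constant [c k.+1] under the
   integral. *)
rewrite (eq_integral_mul _ _ (FF.1 k (ltnW kn)) _ (cst (c k.+1)))//; last first.
  by move=> A FA; exact: integral_difference.
under [X in _ + _ * X]eq_integral do rewrite muleC.
rewrite ge0_integralZl_EFin//; last 2 first.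
- by move=> w _; rewrite lee_fin.
- exact/measurable_EFinP.
rewrite muleA -EFinM -ge0_muleDl; last 2 first.
- by rewrite lee_fin.
- by rewrite lee_fin mulr_ge0.
rewrite -EFinD.
rewrite big_nat_recr//= mulrDr expRD EFinM muleC.
apply: lee_pmul => //.
- by apply: integral_ge0 => w _; rewrite lee_fin.
- by rewrite lee_fin; apply: addr_ge0 => //; exact: mulr_ge0.
rewrite lee_fin.
apply: le_trans (_ : (expR (l * c k.+1) + expR (- (l * c k.+1))) / 2 <= _)%R.
  rewrite /a /b; have := c_ge0 k.+1; rewrite le_eqVlt => /predU1P[<-|ck0].
    by rewrite !(mulr0, oppr0, expR0, addr0); lra.
  rewrite le_eqVlt; apply/orP; left; apply/eqP; field; by rewrite gt_eqF.
apply: le_trans (cosh_le_expR _ lc0) _.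
by rewrite ler_expR exprMn mulrA.
Qed.

Lemma azuma_one_sided (u : R) : (0 <= u)%R ->
  P [set w | u * Num.sqrt (\sum_(1 <= k < n.+1) c k ^+ 2) < M n w - M 0%N w]%R
    <= (expR (- (u ^+ 2 / 8)))%:E.
Proof.
move=> u0; set v := (\sum_(_ <= _ < _) _)%R.
have v0 : (0 <= v)%R by rewrite sumr_ge0// => k _; exact: sqr_ge0.
have mS : measurable_fun setT (fun w => M n w - M 0%N w)%R.
  by apply: measurable_funB; exact: mesM.
have mset a := measurable_set_lt _ _ _ _ a mS.
(* If [v = 0], every difference vanishes almost surely and the event is null. *)
move: v0; rewrite le_eqVlt => /predU1P[v0|v0].
  rewrite -v0 sqrtr0 mulr0.
  have c0 k : (1 <= k <= n)%N -> c k = 0%R.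
    move=> kn; apply/eqP; rewrite -sqrf_eq0 eq_le sqr_ge0 andbT v0 /v.
    rewrite (bigD1_seq k) ?iota_uniq ?mem_index_iota//= lerDl.
    by apply: sumr_ge0 => j _; exact: sqr_ge0.
  have S0 : {ae P, forall w, M n w - M 0%N w <= 0}%R.
    have : {ae P, forall w, forall k : 'I_n, `|difference k.+1 M w| <= c k.+1}%R.
      by apply: filter_forall => k; apply: diff_le; rewrite ltnS ltn_ord.
    apply: filterS => w Dc; rewrite -(telescope_sumr (fun k => M k w))//.
    rewrite big_mkord big1// => k _; apply/eqP; rewrite -normr_le0.
    by apply: le_trans (Dc k) _; rewrite c0// ltnS ltn_ord.
  rewrite (_ : P _ = 0) ?lee_fin ?expR_ge0//.
  apply: measure_negligible; first exact: mset.
  by apply: negligibleS S0 => w /= Sw; apply/negP; rewrite -ltNge.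
have s0 : (0 < Num.sqrt v)%R by rewrite sqrtr_gt0.
(* The minimiser of the Chernoff exponent [- l * u * sqrt v + 2 * l^2 * v], with minimum
   [- u^2 / 8]. *)
pose l := (u / (4 * Num.sqrt v))%R.
have l0 : (0 <= l)%R by rewrite divr_ge0// mulr_ge0// ltW.
pose g w := expR (l * (M n w - M 0%N w)).
have mg : measurable_fun setT g.
  by apply: measurableT_comp => //; exact: measurable_funM.
have ga := markov_ge0 _ _ _ P g (expR (l * (u * Num.sqrt v))) mg
  (fun w => expR_ge0 _) (expR_ge0 _).
have {ga} := le_trans ga (martingale_mgf l n l0 (leqnn n)).
rewrite -lee_pdivlMl ?expR_gt0// -EFinM -expRN -expRD -/v.
have -> : (- (l * (u * Num.sqrt v)) + 2 * l ^+ 2 * v = - (u ^+ 2 / 8))%R.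
  rewrite (_ : 2 * l ^+ 2 * v = 2 * l ^+ 2 * Num.sqrt v ^+ 2)%R.
    by rewrite /l; field; rewrite gt_eqF.
  by rewrite sqr_sqrtr// ltW.
apply: le_trans; apply: le_measure; rewrite ?inE//.
  exact: measurable_set_le.
by move=> w /= h; rewrite ler_expR ler_wpM2l// ltW.
Qed.

End martingale_facts.

(** * The distance between martingales *)

(** Induction on the list: adding one coordinate is the triangle inequality in the plane, for the
    vectors [(a i, x)] and [(b i, y)]. *)
Lemma l2_minkowski {R : rcfType} (I : Type) (s : seq I) (a b c : I -> R) :
  (forall i, 0 <= a i)%R -> (forall i, 0 <= b i)%R ->
  (forall i, 0 <= c i)%R -> all (fun i => c i <= a i + b i)%R s ->
  (Num.sqrt (\sum_(i <- s) c i ^+ 2) <=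
   Num.sqrt (\sum_(i <- s) a i ^+ 2) + Num.sqrt (\sum_(i <- s) b i ^+ 2))%R.
Proof.
move=> a0 b0 c0; elim: s => [|i s IHs]; first by rewrite !big_nil sqrtr0 addr0.
move=> /= /andP[cab /IHs{IHs}].
have sum0 (f : I -> R) : (0 <= \sum_(j <- s) f j ^+ 2)%R.
  by rewrite sumr_ge0// => j _; exact: sqr_ge0.
move: (sqrtr_ge0 (\sum_(j <- s) a j ^+ 2)%R) (sqr_sqrtr (sum0 a))
  (sqrtr_ge0 (\sum_(j <- s) b j ^+ 2)%R) (sqr_sqrtr (sum0 b))
  (sqrtr_ge0 (\sum_(j <- s) c j ^+ 2)%R) (sqr_sqrtr (sum0 c)).
rewrite !big_cons.
move: (Num.sqrt (\sum_(j <- s) a j ^+ 2)) (Num.sqrt (\sum_(j <- s) b j ^+ 2))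
  (Num.sqrt (\sum_(j <- s) c j ^+ 2)) => x y v x0 <- y0 <- v0 <- vxy.
have ci := c0 i; have ai := a0 i; have bi := b0 i.
have p0 : (0 <= a i ^+ 2 + x ^+ 2)%R by rewrite addr_ge0// sqr_ge0.
have q0 : (0 <= b i ^+ 2 + y ^+ 2)%R by rewrite addr_ge0// sqr_ge0.
move: (sqrtr_ge0 (a i ^+ 2 + x ^+ 2)) (sqr_sqrtr p0) (sqrtr_ge0 (b i ^+ 2 + y ^+ 2))
  (sqr_sqrtr q0).
move: (Num.sqrt _) (Num.sqrt (b i ^+ 2 + y ^+ 2)) => p q pp0 pE qq0 qE.
rewrite -[leRHS]ger0_norm ?addr_ge0// -sqrtr_sqr ler_wsqrtr//.
(* Cauchy-Schwarz in the plane: the squares of the two sides differ by [(a i * y - b i * x)^2]. *)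
have pq : (a i * b i + x * y <= p * q)%R.
  rewrite -(@ler_pXn2r _ 2%N) ?nnegrE ?addr_ge0 ?mulr_ge0// exprMn pE qE.
  have := sqr_ge0 (a i * y - b i * x)%R; lra.
have c2 : (c i ^+ 2 <= (a i + b i) ^+ 2)%R by rewrite lerXn2r ?nnegrE ?addr_ge0.
have v2 : (v ^+ 2 <= (x + y) ^+ 2)%R by rewrite lerXn2r ?nnegrE ?addr_ge0.
lra.
Qed.

Section mart_dist_facts.
Context {disp} {Om : measurableType disp} {R : realType} (P : probability Om R).
Context {T : finType} (n : nat) (X : T -> nat -> Om -> R).
Hypothesis mX : forall t k, (k <= n)%N -> measurable_fun setT (X t k).

Let diff s t k : Om -> R := difference k (fun j w => X t j w - X s j w)%R.

Let normdiff s t k : \bar R := 'N[P]_+oo[EFin \o diff s t k].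

(** As [fine] sends +oo to 0, this is the norm only when the norm is finite, which finite distances
    ensure for [1 <= k <= n]. *)
Definition diff_bound s t k : R := fine (normdiff s t k).

Lemma diff_bound_ge0 s t k : (0 <= diff_bound s t k)%R.
Proof. by apply: fine_ge0; exact: Lnorm_ge0. Qed.

Hypothesis dist_fin : forall s t, mart_dist P n X s t < +oo.

Let sum_ge0 s t : 0 <= \sum_(1 <= k < n.+1) normdiff s t k ^+ 2.
Proof. by rewrite sume_ge0// => k _; rewrite expe2 mule_ge0 ?Lnorm_ge0. Qed.

Let normdiff_fin s t k : (1 <= k <= n)%N -> normdiff s t k \is a fin_num.
Proof.
move=> kn; have := dist_fin s t.
rewrite /mart_dist -ge0_fin_numE ?sqrte_ge0// sqrte_fin_num ?sum_ge0//.
move=> /sum_fin_numP /(_ k); rewrite mem_index_iota ltnS kn => /(_ isT isT).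
rewrite -/(diff s t k) -/(normdiff s t k) expe2.
have := Lnorm_ge0 P +oo (EFin \o diff s t k); rewrite -/(normdiff s t k).
by case: (normdiff s t k).
Qed.

Lemma mart_distE s t :
  mart_dist P n X s t = (Num.sqrt (\sum_(1 <= k < n.+1) diff_bound s t k ^+ 2))%:E.
Proof.
rewrite /mart_dist (_ : \sum_(_ <= _ < _) _ =
  (\sum_(1 <= k < n.+1) diff_bound s t k ^+ 2)%:E)//.
rewrite -sumEFin; apply: eq_big_nat => k kn.
by rewrite EFin_expe fineK// normdiff_fin.
Qed.

Lemma difference_le_bound s t k : (1 <= k <= n)%N ->
  {ae P, forall w, `|diff s t k w| <= diff_bound s t k}%R.
Proof.
move=> kn; have NE : normdiff s t k = ess_sup P (abse \o (EFin \o diff s t k)).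
  by rewrite /normdiff unlock ifT// [ltRHS]probability_setT lte01.
have := ess_sup_ge P (abse \o (EFin \o diff s t k)); rewrite -NE.
rewrite -(fineK (normdiff_fin s t k kn)); apply: filterS => w /=.
by rewrite lee_fin.
Qed.

Lemma diff_boundxx t k : diff_bound t t k = 0%R.
Proof.
rewrite /diff_bound /normdiff (_ : EFin \o diff t t k = cst 0) ?Lnorm0//.
by apply/funext => w; rewrite /= /diff /difference !subrr.
Qed.

Lemma diff_boundC s t k : diff_bound s t k = diff_bound t s k.
Proof.
rewrite /diff_bound /normdiff -oppe_Lnorm; congr (fine (Lnorm _ _ _)).
by apply/funext => w; rewrite /= /diff /difference; congr EFin; ring.
Qed.

Lemma diff_bound_triangle r s t k : (1 <= k <= n)%N ->
  (diff_bound r t k <= diff_bound r s k + diff_bound s t k)%R.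
Proof.
move=> kn; rewrite -lee_fin EFinD !fineK ?normdiff_fin//.
have mdiff x y : measurable_fun setT (diff x y k).
  have /andP[_ kn'] := kn.
  have km : (k.-1 <= n)%N by exact: leq_trans (leq_pred k) kn'.
  by apply: measurable_funB; apply: measurable_funB; exact: mX.
apply: le_trans (eminkowski P (mdiff r s) (mdiff s t) (leey _)).
rewrite /normdiff (_ : diff r t k = diff r s k \+ diff s t k)%R//.
by apply/funext => w; rewrite /= /diff /difference; ring.
Qed.

Lemma semi_metric_mart_dist : semi_metric (fun s t => fine (mart_dist P n X s t)).
Proof.
split => [t|s t|r s t]; rewrite !mart_distE/=.
- by rewrite big1 ?sqrtr0// => k _; rewrite diff_boundxx expr0n.
- by congr Num.sqrt; apply: eq_bigr => k _; rewrite diff_boundC.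
- apply: l2_minkowski; try by move=> k; exact: diff_bound_ge0.
  apply/allP => k; rewrite mem_index_iota ltnS; exact: diff_bound_triangle.
Qed.

End mart_dist_facts.

(** * Subgaussian increments of the family, and the tail of its supremum *)

Lemma azuma_two_sided {disp} {Om : measurableType disp} {R : realType}
    (P : probability Om R) (T : finType) (n : nat) (F : nat -> set (set Om))
    (X : T -> nat -> Om -> R) :
  filtration n F -> (forall t, martingale P n F (X t)) ->
  (forall s t, mart_dist P n X s t < +oo) -> forall s t (u : R), (0 <= u)%R ->
  P [set w | (u * fine (mart_dist P n X s t) <
      `|(X t n w - X t 0%N w) - (X s n w - X s 0%N w)|)%R]
    <= (2 * expR (- (u ^+ 2 / 8)))%:E.
Proof.
move=> FF martX dist_fin s t u u0.
have mX r k : (k <= n)%N -> measurable_fun setT (X r k).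
  move=> kn; exact: measurable_wrtW (FF.1 k kn) _ ((martX r).1 k kn).1.
pose S r q w : R := ((X q n w - X r n w) - (X q 0%N w - X r 0%N w))%R.
have mS r q : measurable_fun setT (S r q).
  by apply: measurable_funB; apply: measurable_funB; exact: mX.
have mtail r q a := measurable_set_lt _ _ _ _ a (mS r q).
(* Azuma applies to the martingale [X q - X r]; the two orders of the pair give the two signs of the
   absolute value. *)
have one_sided r q : P [set w | u * fine (mart_dist P n X r q) < S r q w]%R
    <= (expR (- (u ^+ 2 / 8)))%:E.
  rewrite mart_distE//=; apply: (azuma_one_sided P n F FF
    (fun j w => X q j w - X r j w)%R (diff_bound P X r q)) => //.
  - exact: martingaleB.
  - exact: diff_bound_ge0.
  - by move=> k kn; exact: (difference_le_bound P n X).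
have [_ dC _] := semi_metric_mart_dist P n X mX dist_fin.
rewrite (_ : [set w | _] = [set w | u * fine (mart_dist P n X s t) < S s t w]%R `|`
    [set w | u * fine (mart_dist P n X t s) < S t s w]%R); last first.
  apply/seteqP; split => w /=; rewrite (dC t s) real_ltr_normr ?num_real//.
    by move=> /orP[h|h]; [left|right]; move: h; rewrite /S; lra.
  by case=> h; apply/orP; [left|right]; move: h; rewrite /S; lra.
apply: le_trans (measureU2 P (mtail _ _ _) (mtail _ _ _)) _.
rewrite mulr_natl mulr2n EFinD.
exact: leeD (one_sided s t) (one_sided t s).
Qed.

Theorem corollary3p4 (R : realType) :
  exists C2 D2 : R,
    [/\ (0 < C2)%R, (0 < D2)%R, psi2_chaining_bound C2 D2 &
      forall (disp : measure_display) (Om : measurableType disp)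
        (P : probability Om R) (T : finType) (n : nat)
        (F : nat -> set (set Om)) (X : T -> nat -> Om -> R),
      filtration n F ->
      (forall t, martingale P n F (X t)) ->
      (* without the next two hypotheses the bound fails, e.g. when T is a
         singleton *)
      (exists t0 : T, {ae P, forall w, X t0 n w = X t0 0%N w}) ->
      let d := mart_dist P n X in
      0 < diameter d ->
      forall u : R, (1 <= u)%R ->
      P [set w | (Num.sqrt (expR 1))%:E
                   * (C2%:E * gamma2 d + D2%:E * diameter d * u%:E)
                 <= ereal_sup (range (fun t => (`|X t n w - X t 0%N w|%R)%:E))]
        <= (expR (- (u ^+ 2 / 2)))%:E].
Proof.
exists chaining_cst, diameter_cst.
split; [exact: chaining_cst_gt0|exact: diameter_cst_gt0|exact: psi2_chaining|].
move=> disp Om P T n F X FF martX [t0 X0] d diam0 u u1.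
have u0 : (0 < u)%R by exact: lt_le_trans u1.
pose Y t w : R := (X t n w - X t 0%N w)%R.
have mY t : measurable_fun setT (Y t).
  by apply: measurable_funB; apply: measurable_wrtW (FF.1 _ _) _ ((martX t).1 _ _).1.
have d_ge0 s t : 0 <= d s t by exact: sqrte_ge0.
have diam_ge s t : d s t <= diameter d by apply: ereal_sup_ubound; exists (s, t).
have supE w : ereal_sup (range (fun t => (`|X t n w - X t 0%N w|%R)%:E)) =
    (\big[Num.max/0%R]_t `|Y t w|)%:E by exact: (ereal_sup_range_bigmax _ t0).
have e0 : (0 < Num.sqrt (expR 1) :> R)%R by rewrite sqrtr_gt0 expR_gt0.
(* With infinite diameter the threshold is +oo, which a maximum over the finite [T] never
   reaches. *)
have [diamy|diamy] := eqVneq (diameter d) +oo.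
  rewrite [X in P X](_ : _ = set0) ?measure0 ?lee_fin ?expR_ge0//.
  apply/seteqP; split => // w /=.
  rewrite diamy gt0_muley ?lte_fin ?diameter_cst_gt0// gt0_mulye ?lte_fin//.
  rewrite addey; last first.
    rewrite gt_eqF// (lt_le_trans ltNy0)// mule_ge0 ?gamma2_from_ge0//.
    by rewrite lee_fin ltW// chaining_cst_gt0.
  by rewrite gt0_muley ?lte_fin// supE leye_eq.
have dist_fin s t : d s t < +oo.
  by apply: le_lt_trans (diam_ge s t) _; rewrite ltey.
pose dR s t := fine (d s t).
have dE : d = (fun s t => (dR s t)%:E).
  apply/funext => s; apply/funext => t.
  by rewrite /dR fineK// ge0_fin_numE.
have mX r k : (k <= n)%N -> measurable_fun setT (X r k).
  move=> kn; exact: measurable_wrtW (FF.1 k kn) _ ((martX r).1 k kn).1.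
pose rho s t w : R := `|Y t w - Y s w|%R.
have mrho s t : measurable_fun setT (rho s t).
  by apply: measurableT_comp => //; exact: measurable_funB.
have rho_triangle r s t w : (rho r t w <= rho r s w + rho s t w)%R.
  by rewrite addrC; exact: ler_distD.
have tail := @chaining_tail _ _ _ P T dR rho (semi_metric_mart_dist P n X mX dist_fin)
  mrho (fun _ _ _ => normr_ge0 _) rho_triangle
  (azuma_two_sided P T n F X FF martX dist_fin) t0 u.
rewrite -dE in tail; have {}tail := tail diam0 u1.
rewrite -muleA [u%:E * _]muleC in tail.
set thr := _%:E * _ in tail *.
have [N [mN PN subN]] := X0.
have mle (f : T -> Om -> R) : (forall t w, 0 <= f t w)%R ->
    (forall t, measurable_fun setT (f t)) ->
    measurable [set w | thr <= ereal_sup (range (fun t => (f t w)%:E))].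
  move=> f0 mf; rewrite -[X in measurable X]setTI.
  apply: emeasurable_fun_c_infty => //.
  under eq_fun do rewrite (ereal_sup_range_bigmax _ t0)//.
  by apply/measurable_EFinP; exact: measurable_bigmaxr.
have mE1 := mle (fun t w => `|Y t w|%R) (fun _ _ => normr_ge0 _)
  (fun t => measurableT_comp (@normr_measurable R setT) (mY t)).
have mE2 := mle (rho t0) (fun _ _ => normr_ge0 _) (mrho t0).
(* Chaining controls [|Y t - Y t0|]; off the null set [N], [Y t0] is 0 and this is [|Y t|]. *)
apply: (@le_trans _ _ (P [set w | thr <=
  ereal_sup (range (fun t => (rho t0 t w)%:E))] + P N)); last by rewrite PN adde0.
apply: le_trans (measureU2 P mE2 mN); apply: le_measure; rewrite ?inE//.
  exact: measurableU.
move=> w /= w1; have [X0w|X0w] := eqVneq (X t0 n w) (X t0 0%N w); last first.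
  by right; apply: subN; exact/eqP.
left; rewrite (_ : (fun t => (rho t0 t w)%:E) =
  (fun t => (`|X t n w - X t 0%N w|%R)%:E))//.
by apply/funext => t; rewrite /rho {2}/Y X0w subrr subr0.
Qed.
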